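(* Let $X$ be a complex manifold of complex dimension $n$ endowed with a Hermitian metric with associated $(1,1)$-form $\omega$. If the Strominger-Bismut connection of the metric is flat, then the metric is pluriclosed, that is, $\partial\overline\partial\omega=0$.
   Context: Let $g$ be a Hermitian metric on the complex manifold $(X,J)$, $\nabla^{LC}$ its Levi-Civita connection and $\omega(x,y)=g(x,Jy)$. The Strominger-Bismut connection $\nabla^+$ is defined by $g(\nabla^+_xy,z)=g(\nabla^{LC}_xy,z)+\frac12T(x,y,z)$, where $T(x,y,z)=-d\omega(Jx,Jy,Jz)$; it is the unique connection preserving $g$ and $J$ with totally skew-symmetric torsion. Flat means that its curvature vanishes identically. *)

(* Defs.v *)
From HB Require Import structures.
From mathcomp Require Import all_boot all_order all_algebra complex.
From mathcomp Require Import all_classical all_reals.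
From mathcomp Require Import topology normedtype derive.

Set Implicit Arguments.
Unset Strict Implicit.
Unset Printing Implicit Defensive.

Import Order.TTheory GRing.Theory Num.Theory.
Import numFieldNormedType.Exports.

Local Open Scope classical_set_scope.
Local Open Scope ring_scope.
Local Open Scope complex_scope.

(* C^n is identified with R^(n+n) by z_k = x_k + i y_k, where the x_k are the  *)
(* first n coordinates and the y_k the last n.                                *)
Notation cvec R n := 'rV[R]_(n + n).

(* Multiplication by i: (x, y) |-> (-y, x), so J d/dx_k = d/dy_k.             *)
Definition Jst (R : realType) (n : nat) (u : cvec R n) : cvec R n :=
  row_mx (- rsubmx u) (lsubmx u).

Fixpoint iter_derive (R : realType) (m : nat) (s : seq 'rV[R]_m)
    (f : 'rV[R]_m -> R) : 'rV[R]_m -> R :=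
  if s is v :: s' then fun x => 'D_v (iter_derive s' f) x else f.

(* C^infinity on an open set: all iterated directional derivatives exist and  *)
(* are continuous.                                                            *)
Definition smooth_on (R : realType) (m : nat) (U : set 'rV[R]_m)
    (f : 'rV[R]_m -> R) : Prop :=
  forall (s : seq 'rV[R]_m) (x : 'rV[R]_m), U x ->
    {for x, continuous (iter_derive s f)} /\
    (forall v, derivable (iter_derive s f) x v).

(* Also used for vector fields, which are maps to R^m in a chart.             *)
Definition smooth_map_on (R : realType) (m p : nat) (U : set 'rV[R]_m)
    (f : 'rV[R]_m -> 'rV[R]_p) : Prop :=
  forall j : 'I_p, smooth_on U (fun x => f x 0 j).

(* Smooth with complex linear differential.                                   *)
Definition holomorphic_on (R : realType) (n : nat) (U : set (cvec R n))
    (f : cvec R n -> cvec R n) : Prop :=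
  smooth_map_on U f /\
  (forall x, U x -> forall u, 'D_(Jst u) f x = Jst ('D_u f x)).

(* A chart is a homeomorphism from the open set [dom a] onto the open set     *)
(* [cod a]; [chart a] and [chart_inv a] are only meaningful on these sets.    *)
Record complexManifold (R : realType) (n : nat) := ComplexManifold {
  carrier :> topologicalType;
  carrier_hausdorff : hausdorff_space carrier;
  carrier_second_countable : @second_countable carrier;
  chart_index : Type;
  dom : chart_index -> set carrier;
  cod : chart_index -> set (cvec R n);
  chart : chart_index -> carrier -> cvec R n;
  chart_inv : chart_index -> cvec R n -> carrier;
  dom_cover : forall p, exists a, dom a p;
  dom_open : forall a, open (dom a);
  cod_open : forall a, open (cod a);
  chart_cod : forall a p, dom a p -> cod a (chart a p);
  chart_inv_dom : forall a x, cod a x -> dom a (chart_inv a x);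
  chartK : forall a p, dom a p -> chart_inv a (chart a p) = p;
  chart_invK : forall a x, cod a x -> chart a (chart_inv a x) = x;
  chart_continuous : forall a p, dom a p -> {for p, continuous (chart a)};
  chart_inv_continuous :
    forall a x, cod a x -> {for x, continuous (chart_inv a)};
  transition_holomorphic : forall a b,
    holomorphic_on [set x | cod a x /\ dom b (chart_inv a x)]
                   (fun x => chart b (chart_inv a x))
}.
Arguments chart_index {R n} c.
Arguments dom {R n c} a.
Arguments cod {R n c} a.
Arguments chart {R n c} a.
Arguments chart_inv {R n c} a.

Section Geometry.
Context (R : realType) (n : nat) (X : complexManifold R n).
Local Notation vec := (cvec R n).
Local Notation index := (chart_index X).

Definition overlap (a b : index) : set vec :=
  [set x | cod a x /\ dom b (chart_inv a x)].

Definition transition (a b : index) (x : vec) : vec := chart b (chart_inv a x).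

Definition bilin (G : 'M[R]_(n + n)) (u v : vec) : R := (u *m G *m v^T) 0 0.

(* In each chart, the matrix of the metric with respect to the coordinate     *)
(* frame.                                                                     *)
Record hermitianMetric := HermitianMetric {
  metric_mx : index -> vec -> 'M[R]_(n + n);
  metric_smooth :
    forall a i j, smooth_on (cod a) (fun x => metric_mx a x i j);
  metric_sym : forall a x, cod a x ->
    forall u v, bilin (metric_mx a x) u v = bilin (metric_mx a x) v u;
  metric_pos : forall a x, cod a x ->
    forall u, u != 0 -> 0 < bilin (metric_mx a x) u u;
  metric_J : forall a x, cod a x -> forall u v,
    bilin (metric_mx a x) (Jst u) (Jst v) = bilin (metric_mx a x) u v;
  metric_change : forall a b x, overlap a b x -> forall u v,
    bilin (metric_mx a x) u v =
    bilin (metric_mx b (transition a b x))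
      ('D_u (transition a b) x) ('D_v (transition a b) x)
}.

Definition metric (g : hermitianMetric) (a : index) (x u v : vec) : R :=
  bilin (metric_mx g a x) u v.

(* [gamma_mx a x k] has (i, j) entry Gamma^k_ij, the k-th component of the    *)
(* derivative of the j-th coordinate field along the i-th one.                *)
Definition christoffel (G : index -> vec -> 'I_(n + n) -> 'M[R]_(n + n))
    (a : index) (x u v : vec) : vec :=
  \row_k bilin (G a x k) u v.

(* The change-of-chart law applies the connection to the pushforward of the   *)
(* constant field v.                                                          *)
Record affineConnection := AffineConnection {
  gamma_mx : index -> vec -> 'I_(n + n) -> 'M[R]_(n + n);
  gamma_smooth :
    forall a k i j, smooth_on (cod a) (fun x => gamma_mx a x k i j);
  gamma_change : forall a b x, overlap a b x -> forall u v,
    'D_(christoffel gamma_mx a x u v) (transition a b) x =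
    'D_u (fun y => 'D_v (transition a b) y) x +
    christoffel gamma_mx b (transition a b x)
      ('D_u (transition a b) x) ('D_v (transition a b) x)
}.

Definition cov (N : affineConnection) (a : index) (Y Z : vec -> vec)
    (x : vec) : vec :=
  'D_(Y x) Z x + christoffel (gamma_mx N) a x (Y x) (Z x).

Definition lie_bracket (Y Z : vec -> vec) (x : vec) : vec :=
  'D_(Y x) Z x - 'D_(Z x) Y x.

Definition curvature (N : affineConnection) (a : index) (Y Z W : vec -> vec)
    (x : vec) : vec :=
  cov N a Y (cov N a Z W) x - cov N a Z (cov N a Y W) x
  - cov N a (lie_bracket Y Z) W x.

Definition flat (N : affineConnection) : Prop :=
  forall (a : index) (Y Z W : vec -> vec),
    smooth_map_on (cod a) Y -> smooth_map_on (cod a) Z ->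
    smooth_map_on (cod a) W ->
    forall x, cod a x -> curvature N a Y Z W x = 0.

Definition is_levi_civita (g : hermitianMetric) (N : affineConnection) : Prop :=
  (forall (a : index) (Y Z : vec -> vec),
     smooth_map_on (cod a) Y -> smooth_map_on (cod a) Z ->
     forall x, cod a x ->
       cov N a Y Z x - cov N a Z Y x = lie_bracket Y Z x) /\
  (forall (a : index) (Y Z W : vec -> vec),
     smooth_map_on (cod a) Y -> smooth_map_on (cod a) Z ->
     smooth_map_on (cod a) W ->
     forall x, cod a x ->
       'D_(Y x) (fun y => metric g a y (Z y) (W y)) x =
       metric g a x (cov N a Y Z x) (W x) + metric g a x (Z x) (cov N a Y W x)).

(* A K-valued form of degree k in a chart, evaluated at a point on k tangent  *)
(* vectors.                                                                   *)
Definition form (K : Type) (k : nat) := vec -> ('I_k -> vec) -> K.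

(* sum_r (-1)^r (D_(v_r) alpha)(v_0, .., omit v_r, .., v_k), where the v_i    *)
(* are constant in the chart. No factor 1/(k+1) is included.                  *)
Definition ext (K : pzRingType) (D : vec -> (vec -> K) -> vec -> K) (k : nat)
    (alpha : form K k) : form K k.+1 :=
  fun x v => \sum_(r < k.+1)
    (-1) ^+ r * D (v r) (fun y => alpha y (fun i => v (lift r i))) x.

Definition extd (k : nat) (alpha : form R k) : form R k.+1 :=
  @ext R (fun u (f : vec -> R) x => 'D_u f x) k alpha.

Definition derive_cplx (u : vec) (f : vec -> R[i]) (x : vec) : R[i] :=
  'D_u (fun y => complex.Re (f y)) x +i* 'D_u (fun y => complex.Im (f y)) x.

Definition d_x (k : 'I_n) : (vec -> R[i]) -> vec -> R[i] :=
  derive_cplx (delta_mx 0 (lshift n k)).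
Definition d_y (k : 'I_n) : (vec -> R[i]) -> vec -> R[i] :=
  derive_cplx (delta_mx 0 (rshift n k)).

(* [0 +i* 1] rather than ['i], which denotes the abstract [Num.imaginary].     *)
Definition d_z (k : 'I_n) (f : vec -> R[i]) (x : vec) : R[i] :=
  2^-1 * (d_x k f x - (0 +i* 1) * d_y k f x).
Definition d_zbar (k : 'I_n) (f : vec -> R[i]) (x : vec) : R[i] :=
  2^-1 * (d_x k f x + (0 +i* 1) * d_y k f x).

Definition dz (k : 'I_n) (u : vec) : R[i] :=
  u 0 (lshift n k) +i* u 0 (rshift n k).
Definition dzbar (k : 'I_n) (u : vec) : R[i] :=
  u 0 (lshift n k) -i* u 0 (rshift n k).

(* del = sum_k dz_k /\ d/dz_k and delbar = sum_k dzbar_k /\ d/dzbar_k, where  *)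
(* d/dz_k and d/dzbar_k act on the coefficients. A complex-valued form is     *)
(* given by its values on real tangent vectors.                               *)
Definition del (k : nat) (alpha : form R[i] k) : form R[i] k.+1 :=
  ext (fun u f x => \sum_j dz j u * d_z j f x) alpha.
Definition delbar (k : nat) (alpha : form R[i] k) : form R[i] k.+1 :=
  ext (fun u f x => \sum_j dzbar j u * d_zbar j f x) alpha.

(* Sign convention: omega(x, y) = g(x, J y).                                  *)
Definition fund_form (g : hermitianMetric) (a : index) : form R 2 :=
  fun x v => metric g a x (v ord0) (Jst (v ord_max)).

Definition torsion_form (g : hermitianMetric) (a : index) : form R 3 :=
  fun x v => - extd (fund_form g a) x (fun i => Jst (v i)).

Definition is_strominger_bismut (g : hermitianMetric) (N : affineConnection) :
    Prop :=
  exists LC : affineConnection, is_levi_civita g LC /\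
  forall (a : index) (Y Z W : vec -> vec),
    smooth_map_on (cod a) Y -> smooth_map_on (cod a) Z ->
    smooth_map_on (cod a) W ->
    forall x, cod a x ->
      metric g a x (cov N a Y Z x) (W x) =
      metric g a x (cov LC a Y Z x) (W x) +
      2^-1 * torsion_form g a x (tnth [tuple Y x; Z x; W x]).

Definition pluriclosed (g : hermitianMetric) : Prop :=
  forall (a : index) (x : vec), cod a x -> forall v : 'I_4 -> vec,
    del (delbar (fun y w => (fund_form g a y w)%:C)) x v = 0.

End Geometry.

(* Main.v *)
Require Import Defs.
From HB Require Import structures.
From mathcomp Require Import all_boot all_order all_algebra complex ring lra.
From mathcomp Require Import all_classical all_reals.
From mathcomp Require Import topology normedtype derive.

Set Implicit Arguments.
Unset Strict Implicit.
Unset Printing Implicit Defensive.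

Import Order.TTheory GRing.Theory Num.Theory.
Import numFieldNormedType.Exports.

Local Open Scope classical_set_scope.
Local Open Scope ring_scope.

(** Let [T] be the torsion of the flat connection and [J] the complex structure.
    The metric turns [T] into a three-form, equal to minus d omega with [J]
    applied to all three arguments, and up to a constant factor the second
    differential del delbar omega is the exterior derivative of this form.  So
    the theorem says that the torsion form is closed.  The proof shows more: [T]
    is parallel and satisfies the Jacobi identity.

    Let [Jac] be the Jacobiator, the cyclic sum of T(T(x,y),z), and sigma the
    four-form it defines through the metric.  Flatness gives the first Bianchi
    identity: the cyclic sum of the covariant derivative of [T] is minus
    [Jac].  As the derivative of [T] is skew in its last three slots, this makes
    it equal to minus a third of [Jac] (lemma [covTor_Jac]); everything then
    follows from [Jac] being zero.  For this the complex structure is essential: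
    the seven-sphere has a flat metric connection whose skew torsion is not
    parallel.

    The connection preserves [J], which is constant in the chart, so [T] has type
    (2,1)+(1,2).  Its covariant derivative inherits this type, therefore sigma has
    no part that is pure in three slots, and sigma and its covariant derivative
    have type (2,2) ([Jac_type], [covJac_type]).  Flatness on second derivatives
    of [T] gives a Ricci identity for [Jac] ([ricci_Jac]).  What remains is algebra in one Hermitian vector
    space ([torsion_square_eq0]).  Write [b] for twice the real part of the (2,1)
    part of [T], which is a complex-bilinear bracket, and [s] for twice the real
    part of the component of sigma of type (2,0) in the first two arguments and
    (0,2) in the last two.
    - The vanishing (3,1) part of sigma is the Jacobi identity of [b].  Its trace
      kills the trace tau of [b] along brackets; the same identity for the
      covariant derivative of sigma, traced, ties the Ricci-type contraction
      ric of [s] to tau ([jacobi_polar], [trace_jacobi_polar]).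
    - The Ricci identity in directions of mixed type makes the contraction of [b]
      with [s] over one index skew in two of its remaining arguments.
    - [s] is a quadratic expression in [b].
    From these, [contraction_vanishing] obtains in turn that ric annihilates tau,
    that the squared norm of ric is zero, and that the squared norm of [s] is
    zero, each time by substituting the quadratic formula for one factor and
    finding in every term a contraction already known to vanish.

    Once [Jac] is zero, the closedness of [T] is the Leibniz rule
    ([torsion_closed]).  All computations take place in one chart with constant
    coordinate fields.  The second derivatives of the metric are expressed
    through covariant derivatives, so that their symmetry is another instance of
    flatness ([hessC]) and needs no theorem on mixed partial derivatives. *)

(** * Contractions of a bracket and a four-form *)

Section Contractions.
Context (R : realFieldType) (I : finType).
(** [b] and [s] stand for the coefficients in an orthonormal basis of a complex
    bracket and of a component of a (2,2)-form. *)
Variables (b : I -> I -> I -> R) (s : I -> I -> I -> I -> R).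
Let tau l := \sum_k b k l k.
Let ric j l := \sum_c s c j c l.
Hypothesis b12 : forall x y z, b y x z = - b x y z.
Hypothesis s12 : forall x y k l, s y x k l = - s x y k l.
Hypothesis s_pair : forall x y k l, s k l x y = s x y k l.
Hypothesis b_tau : forall x y, \sum_a b x y a * tau a = 0.
Hypothesis s_tau : forall x y q,
  \sum_a s x y q a * tau a = \sum_a b x y a * ric a q.
Hypothesis bs_skew : forall x y z u v,
  \sum_a b y a x * s z u a v = - \sum_a b y a v * s z u a x.
Hypothesis s_quad : forall x y k l, s x y k l =
  \sum_a (b x y a * b k l a - b a y k * b a l x - b a k y * b a x l
          + b a x k * b a l y + b a k x * b a y l).

Let s34 x y k l : s x y l k = - s x y k l.
Proof. by rewrite s_pair s12 s_pair. Qed.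

Let ricC j l : ric j l = ric l j.
Proof. by apply: eq_bigr => c _; rewrite s_pair. Qed.

Let ric_out j l : \sum_c s j c c l = - ric j l.
Proof. by rewrite -sumrN; apply: eq_bigr => c _; rewrite s12. Qed.

Let tauN a : \sum_i b a i i = - tau a.
Proof. by rewrite -sumrN; apply: eq_bigr => i _; rewrite b12. Qed.

(** [bs_skew] moves the free index [p] from [b] to [s]. *)
Let b_s_contract x y p :
  \sum_k \sum_l b k l p * s x y k l = \sum_l tau l * s x y l p.
Proof.
transitivity (\sum_k \sum_l b k l k * s x y l p).
  apply: eq_bigr => k _; rewrite -[RHS]opprK -bs_skew -sumrN.
  by apply: eq_bigr => l _; rewrite s34 mulrN.
rewrite exchange_big; apply: eq_bigr => l _.
by rewrite /tau mulr_suml.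
Qed.

(** Tracing [s_quad]: the first two quadratic terms cancel, and the fourth and
    fifth produce [tau]. *)
Let ric_quad j l : ric j l = - (\sum_a \sum_i b a i j * b a i l)
  - \sum_a tau a * (b a l j + b a j l).
Proof.
rewrite /ric (eq_bigr _ (fun c _ => s_quad c j c l)) exchange_big /=.
rewrite -sumrN -sumrB.
have -> : \sum_j0 \sum_i (b i j j0 * b i l j0 - b j0 j i * b j0 l i
       - b j0 i j * b j0 i l + b j0 i i * b j0 l j + b j0 i i * b j0 j l) =
   (\sum_j0 \sum_i b i j j0 * b i l j0 - \sum_j0 \sum_i b j0 j i * b j0 l i) +
   \sum_j0 (- (\sum_i b j0 i j * b j0 i l) - tau j0 * (b j0 l j + b j0 j l)).
  rewrite -sumrB -big_split; apply: eq_bigr => a _.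
  rewrite -sumrB -mulNr -tauN mulr_suml -sumrN -!big_split /=.
  by apply: eq_bigr => i _; ring.
by rewrite exchange_big /= subrr add0r.
Qed.

(** After [ric_quad] every term either contains [b] contracted with [tau] in the
    last slot, which is zero by [b_tau], or pairs [b], skew in its first two
    slots, with the symmetric product of [tau] with itself. *)
Let ric_tau l : \sum_j ric j l * tau j = 0.
Proof.
have -> : \sum_j ric j l * tau j =
  - (\sum_a \sum_i b a i l * \sum_j b a i j * tau j)
  - (\sum_a tau a * \sum_j b a l j * tau j)
  - \sum_a \sum_j tau a * tau j * b a j l.
  transitivity (- (\sum_j \sum_a \sum_i b a i l * (b a i j * tau j))
    - (\sum_j \sum_a tau a * (b a l j * tau j))
    - \sum_j \sum_a tau a * tau j * b a j l).
    rewrite -!sumrN -!big_split; apply: eq_bigr => j _ /=.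
    rewrite ric_quad mulrDl !mulNr !mulr_suml -!sumrN -!big_split /=.
    apply: eq_bigr => a _; rewrite mulr_suml -addrA; congr (- _ + _).
      by apply: eq_bigr => i _; ring.
    by ring.
  congr (- _ - _ - _); last by rewrite exchange_big.
    rewrite exchange_big /=; apply: eq_bigr => a _.
    rewrite exchange_big /=; apply: eq_bigr => i _.
    by rewrite mulr_sumr.
  by rewrite exchange_big /=; apply: eq_bigr => a _; rewrite mulr_sumr.
have h0 : \sum_a \sum_j tau a * tau j * b a j l = 0.
  have h : \sum_a \sum_j tau a * tau j * b a j l =
         - \sum_a \sum_j tau a * tau j * b a j l.
    rewrite {1}exchange_big /= -sumrN; apply: eq_bigr => a _.
    by rewrite -sumrN; apply: eq_bigr => j _; rewrite b12; ring.
  lra.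
rewrite h0 subr0 big1 ?big1 ?oppr0 ?addr0 // => a _.
  by rewrite b_tau mulr0.
by rewrite big1 // => i _; rewrite b_tau mulr0.
Qed.

Let tau_ric l : \sum_j tau j * ric l j = 0.
Proof.
transitivity (\sum_j ric j l * tau j); last exact: ric_tau.
by apply: eq_bigr => j _; rewrite mulrC ricC.
Qed.

(** Read from right to left, [s_tau] replaces [b] contracted with [ric] by [s]
    contracted with [tau]; tracing once more yields [ric] against [tau]. *)
Let b_ric a : \sum_j \sum_l b a j l * ric j l = 0.
Proof.
transitivity (\sum_j \sum_m s a j j m * tau m).
  apply: eq_bigr => j _; rewrite s_tau.
  by apply: eq_bigr => l _; rewrite [ric l j]ricC.
transitivity (- \sum_j tau j * ric a j); last by rewrite tau_ric oppr0.
rewrite exchange_big /= -sumrN.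
apply: eq_bigr => m _.
by rewrite -mulr_suml ric_out mulNr mulrC.
Qed.

Let sumsq0 (f : I -> I -> R) : \sum_j \sum_l f j l * f j l = 0 ->
  forall j l, f j l = 0.
Proof.
move=> h j l; have f2 i k : 0 <= f i k * f i k by rewrite -expr2 sqr_ge0.
have hj := (psumr_eq0P (fun i _ => sumr_ge0 _ (fun k _ => f2 i k)) h) j isT.
have /eqP := (psumr_eq0P (fun k _ => f2 j k) hj) l isT.
by rewrite mulf_eq0 orbb => /eqP.
Qed.

(** The same exchange as for [b_ric] leaves a contraction of [b] with [s], which
    [b_s_contract] turns again into [ric] against [tau]. *)
Let bb_ric : \sum_j \sum_l (\sum_a \sum_i b a i j * b a i l) * ric j l = 0.
Proof.
transitivity (\sum_l \sum_a \sum_i b a i l * \sum_m s a i l m * tau m).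
  rewrite exchange_big /=; apply: eq_bigr => l _.
  under eq_bigr do rewrite mulr_suml.
  rewrite exchange_big /=; apply: eq_bigr => a _.
  under eq_bigr do rewrite mulr_suml.
  rewrite exchange_big /=; apply: eq_bigr => i _.
  by rewrite s_tau mulr_sumr; apply: eq_bigr => j _; ring.
transitivity (\sum_m tau m * \sum_l \sum_a \sum_i b a i l * s l m a i).
  under eq_bigr do under eq_bigr do under eq_bigr do rewrite mulr_sumr.
  under eq_bigr do under eq_bigr do rewrite exchange_big /=.
  under eq_bigr do rewrite exchange_big /=.
  rewrite exchange_big /=; apply: eq_bigr => m _; rewrite mulr_sumr.
  apply: eq_bigr => l _; rewrite mulr_sumr; apply: eq_bigr => a _.
  rewrite mulr_sumr; apply: eq_bigr => i _.
  by rewrite [s l m a i]s_pair; ring.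
apply: big1 => m _; apply/eqP; rewrite mulf_eq0; apply/orP; right; apply/eqP.
under eq_bigr do rewrite b_s_contract.
transitivity (- \sum_j tau j * ric m j); last by rewrite tau_ric oppr0.
rewrite exchange_big /= -sumrN; apply: eq_bigr => t _.
rewrite -mulr_sumr -mulrN; congr (_ * _); rewrite -sumrN.
by apply: eq_bigr => l _; rewrite s34.
Qed.

(** The squared norm of [ric], one factor being expanded by [ric_quad]. *)
Let ric0 j l : ric j l = 0.
Proof.
move: j l; apply: sumsq0.
have -> : \sum_j \sum_l ric j l * ric j l =
  - (\sum_j \sum_l (\sum_a \sum_i b a i j * b a i l) * ric j l)
  - \sum_a tau a * (\sum_l \sum_j b a l j * ric l j
                    + \sum_j \sum_l b a j l * ric j l).
  transitivity (- (\sum_j \sum_l (\sum_a \sum_i b a i j * b a i l) * ric j l)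
    - \sum_j \sum_l \sum_a tau a * (b a l j * ric l j + b a j l * ric j l)).
    rewrite -!sumrN -big_split; apply: eq_bigr => j _.
    rewrite -!sumrN -big_split; apply: eq_bigr => l _ /=.
    rewrite {1}ric_quad mulrDl !mulNr; congr (_ - _); rewrite mulr_suml.
    by apply: eq_bigr => a _; rewrite [ric l j]ricC; ring.
  congr (_ - _).
  under eq_bigr do rewrite exchange_big /=.
  rewrite exchange_big /=; apply: eq_bigr => a _.
  under eq_bigr do rewrite -mulr_sumr big_split /=.
  by rewrite -mulr_sumr big_split /=; congr (_ * (_ + _)); rewrite exchange_big.
rewrite bb_ric oppr0 add0r; apply/eqP; rewrite oppr_eq0; apply/eqP.
by apply: big1 => a _; rewrite !b_ric addr0 mulr0.
Qed.

Let b_s_all x y p : \sum_k \sum_l b k l p * s x y k l = 0.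
Proof.
rewrite b_s_contract; transitivity (- \sum_a s x y p a * tau a).
  by rewrite -sumrN; apply: eq_bigr => l _; rewrite s34; ring.
by rewrite s_tau big1 ?oppr0 // => a _; rewrite ric0 mulr0.
Qed.

Let b_s_mixed a x l : \sum_y \sum_k b a y k * s x y k l = 0.
Proof.
transitivity (\sum_k \sum_y b a y x * s k l y k).
  rewrite exchange_big; apply: eq_bigr => k _ /=.
  rewrite -[RHS]opprK -bs_skew -sumrN; apply: eq_bigr => y _.
  by rewrite s_pair [s k l y x]s34; ring.
rewrite exchange_big big1 // => y _ /=.
rewrite -mulr_sumr (eq_bigr (fun k => - s k l k y)) => [|k _]; last by rewrite s34.
by rewrite sumrN -/(ric l y) ric0 oppr0 mulr0.
Qed.

(** The squared norm of [s], one factor being expanded by [s_quad], is a sum of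
    five terms: the first is [b_s_all], and the other four are [b_s_mixed] up to
    the symmetries of [s]. *)
Lemma contraction_vanishing x y k l : s x y k l = 0.
Proof.
move: k l; apply: sumsq0.
have h : \sum_x \sum_y \sum_k \sum_l s x y k l * s x y k l = 0.
  have t1 : \sum_x \sum_y \sum_k \sum_l \sum_a b x y a * (b k l a * s x y k l) = 0.
    apply: big1 => {}x _; apply: big1 => {}y _.
    under eq_bigr do rewrite exchange_big /=.
    rewrite exchange_big /=; apply: big1 => a _.
    by under eq_bigr do rewrite -mulr_sumr; rewrite -mulr_sumr b_s_all mulr0.
  have t2 : \sum_x \sum_y \sum_k \sum_l \sum_a b a l x * (b a y k * s x y k l) = 0.
    apply: big1 => {}x _.
    under eq_bigr do rewrite exchange_big /=.
    rewrite exchange_big /=; apply: big1 => l _.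
    under eq_bigr do rewrite exchange_big /=.
    rewrite exchange_big /=; apply: big1 => a _.
    by under eq_bigr do rewrite -mulr_sumr; rewrite -mulr_sumr b_s_mixed mulr0.
  have t3 : \sum_x \sum_y \sum_k \sum_l \sum_a b a x l * (b a k y * s l k y x) = 0.
    apply: big1 => {}x _.
    under eq_bigr do rewrite exchange_big /=.
    rewrite exchange_big /=; apply: big1 => l _.
    under eq_bigr do rewrite exchange_big /=.
    rewrite exchange_big /=; apply: big1 => a _.
    rewrite exchange_big /=.
    by under eq_bigr do rewrite -mulr_sumr; rewrite -mulr_sumr b_s_mixed mulr0.
  have t4 : \sum_x \sum_y \sum_k \sum_l \sum_a b a l y * (b a x k * s y x k l) = 0.
    rewrite exchange_big; exact: t2.
  have t5 : \sum_x \sum_y \sum_k \sum_l \sum_a b a y l * (b a k x * s l k x y) = 0.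
    rewrite exchange_big; exact: t3.
  transitivity (0 - 0 - 0 - 0 - 0 : R); last by rewrite !subr0.
  rewrite -[in X in X - _ - _ - _ - _]t1 -[in X in _ - X - _ - _ - _]t2.
  rewrite -[in X in _ - X - _ - _]t3 -[in X in _ - X - _]t4 -[in X in _ - X]t5.
  rewrite -!sumrN -!big_split; apply: eq_bigr => {}x _.
  rewrite -!sumrN -!big_split; apply: eq_bigr => {}y _.
  rewrite -!sumrN -!big_split; apply: eq_bigr => k _.
  rewrite -!sumrN -!big_split; apply: eq_bigr => l _.
  rewrite -!sumrN -!big_split {1}s_quad mulr_suml; apply: eq_bigr => a _ /=.
  have e3 : s l k y x = s x y k l by rewrite s_pair s12 s34 opprK.
  have e5 : s l k x y = - s x y k l by rewrite s_pair s34.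
  by rewrite e3 e5 [s y x k l]s12; ring.
have f2 i j m n : 0 <= s i j m n * s i j m n by rewrite -expr2 sqr_ge0.
have hx := (psumr_eq0P (fun i _ => sumr_ge0 _ (fun j _ => sumr_ge0 _
  (fun m _ => sumr_ge0 _ (fun n _ => f2 i j m n)))) h) x isT.
exact: (psumr_eq0P (fun j _ => sumr_ge0 _
  (fun m _ => sumr_ge0 _ (fun n _ => f2 x j m n))) hx) y isT.
Qed.
End Contractions.

(** * Forms of type (2,1)+(1,2) and (2,2) *)
Section HermitianAlgebra.
Context (R : realFieldType) (E : lmodType R) (J : E -> E).
Hypothesis J_lin : forall a u v, J (a *: u + v) = a *: J u + J v.
Hypothesis JJ : forall x, J (J x) = - x.

Definition lin (f : E -> R) := forall a u v, f (a *: u + v) = a * f u + f v.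

Lemma linN f x : lin f -> f (- x) = - f x.
Proof.
move=> h; have h0 : f 0 = 0.
  by have := h 1 0 0; rewrite scaler0 addr0 mul1r => /esym/eqP; rewrite -subr_eq0 addrK => /eqP.
by have := h (-1) x 0; rewrite addr0 scaleN1r mulN1r h0 addr0.
Qed.

Lemma lin_sum (I : finType) f (c : I -> R) (u : I -> E) : lin f ->
  f (\sum_i c i *: u i) = \sum_i c i * f (u i).
Proof.
move=> h; elim/big_rec2: _ => [|i y1 y2 _ <-]; last exact: h.
by have := linN 0 h; rewrite oppr0 => h0; lra.
Qed.

(** Applying [J] in two slots multiplies a component by -1 if the two slots have
    the same type and by 1 otherwise.  On a (3,0) part the three terms of
    [form21_type] therefore add up to -3, and on a (2,1) part to -1 + 1 + 1 = 1:
    the condition says exactly that there is no (3,0) and no (0,3) part. *)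
Record form21 (T : E -> E -> E -> R) : Prop := Form21 {
  form21_lin : forall x y, lin (T x y);
  form21_12 : forall x y z, T y x z = - T x y z;
  form21_23 : forall x y z, T x z y = - T x y z;
  form21_type : forall x y z,
    T x y z = T (J x) (J y) z + T (J x) y (J z) + T x (J y) (J z) }.

(** No triple of slots has a pure part, which leaves only the type (2,2). *)
Record form22 (A : E -> E -> E -> E -> R) : Prop := Form22 {
  form22_form21 : forall v, form21 (A v);
  form22_12 : forall v x y z, A x v y z = - A v x y z }.

Section Form21.
Variable T : E -> E -> E -> R.
Hypothesis fT : form21 T.

Lemma form21_rot x y z : T y z x = T x y z.
Proof. by rewrite (form21_23 fT) (form21_12 fT) opprK. Qed.
Lemma form21_N3 x y z : T x y (- z) = - T x y z.
Proof. exact: linN (form21_lin fT x y). Qed.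
Lemma form21_N1 x y z : T (- x) y z = - T x y z.
Proof. by rewrite -form21_rot form21_N3 form21_rot. Qed.
Lemma form21_N2 x y z : T x (- y) z = - T x y z.
Proof. by rewrite (form21_12 fT (- y)) form21_N1 (form21_12 fT x) opprK. Qed.

Lemma form21_lin2 x z : lin (T x ^~ z).
Proof. by move=> a u v; rewrite !(form21_23 fT x z) (form21_lin fT); ring. Qed.
Lemma form21_lin1 y z : lin (fun x => T x y z).
Proof. by move=> a u v; rewrite -!(form21_rot _ y z) (form21_lin fT). Qed.

(** Twice the real part of the component of [T] that is complex linear in the
    first two arguments and antilinear in the third. *)
Definition holo x y z := 2^-1 * (T x y z - T (J x) (J y) z).

Lemma holo12 x y z : holo y x z = - holo x y z.
Proof. by rewrite /holo (form21_12 fT x) (form21_12 fT (J x)); ring. Qed.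

Lemma holo_J12 x y z : holo (J x) y z = holo x (J y) z.
Proof. by rewrite /holo !JJ form21_N1 form21_N2; ring. Qed.

Lemma holo_J13 x y z : holo (J x) y z = - holo x y (J z).
Proof.
have := form21_type fT x y (J z); rewrite /holo !JJ form21_N1 !form21_N3.
lra.
Qed.

Lemma holo_J23 x y z : holo x (J y) z = - holo x y (J z).
Proof. by rewrite -holo_J12 holo_J13. Qed.

(** Each component of [T] has exactly one slot of the minority type. *)
Lemma holo_sum x y z : T x y z = holo x y z + holo y z x + holo z x y.
Proof.
have := form21_type fT x y z; rewrite /holo.
have := form21_rot x y z; have := form21_rot z x y.
have := form21_rot x (J y) (J z); have := form21_rot (J z) (J x) y.
lra.
Qed.

Lemma holo_lin3 x y : lin (holo x y).
Proof. by move=> a u v; rewrite /holo !(form21_lin fT); ring. Qed.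
Lemma holo_lin2 x z : lin (holo x ^~ z).
Proof. by move=> a u v; rewrite /holo J_lin !form21_lin2; ring. Qed.
End Form21.

Section Form22.
Variable A : E -> E -> E -> E -> R.
Hypothesis fA : form22 A.
Let A21 v := form22_form21 fA v.

Lemma form22_23 v x y z : A v y x z = - A v x y z.
Proof. exact: form21_12 (A21 v) _ _ _. Qed.
Lemma form22_34 v x y z : A v x z y = - A v x y z.
Proof. exact: form21_23 (A21 v) _ _ _. Qed.
Lemma form22_N1 v x y z : A (- v) x y z = - A v x y z.
Proof. by rewrite (form22_12 fA) (form21_N1 (A21 x)) (form22_12 fA) opprK. Qed.
Lemma form22_N2 v x y z : A v (- x) y z = - A v x y z.
Proof. exact: form21_N1 (A21 v) _ _ _. Qed.
Lemma form22_N3 v x y z : A v x (- y) z = - A v x y z.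
Proof. exact: form21_N2 (A21 v) _ _ _. Qed.
Lemma form22_N4 v x y z : A v x y (- z) = - A v x y z.
Proof. exact: form21_N3 (A21 v) _ _ _. Qed.
Lemma form22_rot v x y z : A x y z v = - A v x y z.
Proof.
by rewrite form22_34 form22_23 (form22_12 fA); ring.
Qed.
Lemma form22_pair x y k l : A k l x y = A x y k l.
Proof. by rewrite (form22_rot y) (form22_rot x) opprK. Qed.

(* The type condition of [form21] holds in the triple of slots that omits any
   chosen one, by skew symmetry. *)
Let ty1 v x y z : A v x y z = A v (J x) (J y) z + A v (J x) y (J z)
  + A v x (J y) (J z).
Proof. exact: form21_type (A21 v) _ _ _. Qed.
Let ty2 v x y z : A v x y z = A (J v) x (J y) z + A (J v) x y (J z)
  + A v x (J y) (J z).
Proof.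
have := ty1 x v y z.
by rewrite ![A x _ _ _](form22_12 fA); lra.
Qed.
Let ty3 v x y z : A v x y z = A (J v) (J x) y z + A (J v) x y (J z)
  + A v (J x) y (J z).
Proof.
have := ty2 v y x z.
by rewrite !(form22_23 _ x y) !(form22_23 _ (J x) y); lra.
Qed.
Let ty4 v x y z : A v x y z = A (J v) (J x) y z + A (J v) x (J y) z
  + A v (J x) (J y) z.
Proof.
have := ty3 v x z y.
rewrite !(form22_34 _ _ y z) !(form22_34 _ _ (J y) z); lra.
Qed.

(** Two slots of a (2,2) component have the same type exactly when the other two
    have. *)
Lemma form22_even x y k l : A (J x) (J y) k l = A x y (J k) (J l).
Proof.
have := (ty1 x y k l, ty2 x y k l, ty3 x y k l, ty4 x y k l).
move=> [[[h1 h2] h3] h4].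
have := (ty1 (J x) (J y) k l); have := ty1 (J x) y (J k) l.
have := ty1 (J x) y k (J l).
rewrite !JJ !(form22_N2, form22_N3, form22_N4); lra.
Qed.

(** As a derivation, [J] multiplies a component of type (p,q) by i(p - q). *)
Lemma form22_der x y k l :
  A (J x) y k l + A x (J y) k l + A x y (J k) l + A x y k (J l) = 0.
Proof.
have := ty1 (J x) y k l; have := ty1 x (J y) k l.
have := ty2 (J x) y k l; have := ty3 (J x) y k l; have := ty4 (J x) y k l.
rewrite !JJ !(form22_N1, form22_N2, form22_N3, form22_N4); lra.
Qed.

Lemma form22_odd x y k l : A (J x) (J y) (J k) l = - A x y k (J l).
Proof.
have := form22_der x y k l; have := ty4 (J x) y k l.
rewrite !JJ !(form22_N1, form22_N2, form22_N3, form22_N4); lra.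
Qed.

(** Twice the real part of the component of [A] that is complex linear in the
    first two arguments and antilinear in the last two. *)
Definition mixed x y k l := 2^-1 * (A x y k l - A (J x) (J y) k l).

Lemma mixed12 x y k l : mixed y x k l = - mixed x y k l.
Proof. by rewrite /mixed (form22_12 fA x) (form22_12 fA (J x)); ring. Qed.
Lemma mixed34 x y k l : mixed x y l k = - mixed x y k l.
Proof. by rewrite /mixed !(form22_34 _ _ k); ring. Qed.
Lemma mixed_pair x y k l : mixed k l x y = mixed x y k l.
Proof. by rewrite /mixed form22_even !(form22_pair _ _ k l) form22_pair. Qed.
Lemma mixed_J34 x y k l : mixed x y (J k) l = mixed x y k (J l).
Proof.
rewrite /mixed form22_odd (form22_even x y k (J l)) JJ form22_N4; ring.
Qed.
Lemma mixed_JJ x y k l : mixed x y (J k) (J l) = - mixed x y k l.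
Proof.
by rewrite mixed_J34 JJ /mixed !form22_N4; ring.
Qed.
(** The three terms correspond to the slot which has the type of the first one. *)
Lemma mixed_sum x y z w : A x y z w = mixed x y z w + mixed x z w y
  + mixed x w y z.
Proof.
have := form22_der (J x) y z w; rewrite /mixed JJ form22_N1.
rewrite (form22_34 _ _ y w) (form22_23 x y z) -(form22_34 x).
have := form22_34 x y z w; have := form22_34 x z y w; have := form22_23 x y z w.
have := form22_23 x y w z; have := form22_34 x w y z.
have := form22_34 (J x) (J z) y w; have := form22_23 (J x) y (J z) w.
have := form22_23 (J x) y (J w) z; have := form22_34 (J x) y z (J w).
lra.
Qed.
Lemma mixed_lin3 x y l : lin (fun k => mixed x y k l).
Proof.
by move=> a u v; rewrite /mixed !(form21_lin2 (A21 _)); ring.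
Qed.
End Form22.

(** * Vanishing of the Jacobiator of a torsion tensor *)
Section Traces.
Context (I : finType) (e : I -> E) (g : E -> E -> R).
Hypothesis g_sym : forall x y, g x y = g y x.
Hypothesis g_J : forall x y, g (J x) y = - g x (J y).
Hypothesis e_expand : forall x, x = \sum_a g x (e a) *: e a.

Lemma lin_expand (f : E -> R) x : lin f -> f x = \sum_a g x (e a) * f (e a).
Proof. by move=> hf; rewrite {1}[x]e_expand (lin_sum _ _ hf). Qed.

(** [J] is skew for the metric, so a contraction over an orthonormal basis pairs
    a complex linear slot only with an antilinear one. *)
Lemma trace_J (f h : E -> R) : lin f -> lin h ->
  \sum_a f (J (e a)) * h (e a) = - \sum_a f (e a) * h (J (e a)).
Proof.
move=> hf hh.
under eq_bigr do rewrite (lin_expand _ hf) mulr_suml.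
rewrite exchange_big /= -sumrN; apply: eq_bigr => a _.
rewrite (lin_expand (J (e a)) hh) mulr_sumr -sumrN.
by apply: eq_bigr => c _; rewrite g_J [g (e c) _]g_sym; ring.
Qed.

Lemma trace_JJ (f h : E -> R) : lin f -> lin h ->
  \sum_a f (J (e a)) * h (J (e a)) = \sum_a f (e a) * h (e a).
Proof.
move=> hf hh; have hJ : lin (h \o J) by move=> a u v /=; rewrite J_lin hh.
rewrite (trace_J hf hJ) -sumrN; apply: eq_bigr => a _ /=.
by rewrite JJ (linN _ hh) mulrN opprK.
Qed.

(** With the metric used to view T1 and T2 as products, [contr2 T1 T2 x y z w] is
    the inner product of T1(x,y) and T2(z,w), and [comp2 b1 b2 x y z w] that of
    b2(b1(x,y),z) and [w].  The polarised Jacobiator of T1 and T2 is the sum of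
    [cyc2 T1 T2] and [cyc2 T2 T1]. *)
Definition contr2 (T1 T2 : E -> E -> E -> R) x y z w :=
  \sum_a T1 x y (e a) * T2 z w (e a).
Definition cyc2 T1 T2 x y z w :=
  contr2 T1 T2 x y z w + contr2 T1 T2 y z x w + contr2 T1 T2 z x y w.
Definition comp2 (b1 b2 : E -> E -> E -> R) x y z w :=
  \sum_a b1 x y (e a) * b2 (e a) z w.

(** The right-hand side projects onto the part where [x], [y], [z] have the same
    type.  In the contraction the basis vector has then the opposite type in T1,
    hence the common one in T2. *)
Lemma comp2_holo (T1 T2 : E -> E -> E -> R) x y z w :
  form21 T1 -> form21 T2 -> comp2 (holo T1) (holo T2) x y z w =
  4^-1 * (contr2 T1 T2 x y z w - contr2 T1 T2 (J x) (J y) z w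
    - contr2 T1 T2 (J x) y (J z) w - contr2 T1 T2 x (J y) (J z) w).
Proof.
move=> h1 h2.
have -> : comp2 (holo T1) (holo T2) x y z w =
    2^-1 * (\sum_a holo T1 x y (e a) * T2 (e a) z w
            - \sum_a holo T1 x y (e a) * T2 (J (e a)) (J z) w).
  rewrite -sumrB mulr_sumr; apply: eq_bigr => a _.
  by rewrite {2}/holo; ring.
have -> : \sum_a holo T1 x y (e a) * T2 (J (e a)) (J z) w =
    \sum_a holo T1 (J x) y (e a) * T2 (e a) (J z) w.
  rewrite -[LHS]opprK -(trace_J (holo_lin3 h1 x y) (form21_lin1 h2 (J z) w)).
  rewrite -sumrN; apply: eq_bigr => a _.
  by rewrite (holo_J13 h1); ring.
rewrite /contr2 -!sumrB !mulr_sumr; apply: eq_bigr => a _.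
rewrite -!(form21_rot h2 (e a)) /holo JJ (form21_N1 h1); lra.
Qed.

Section Polar.
Variables T1 T2 : E -> E -> E -> R.
Hypotheses (h1 : form21 T1) (h2 : form21 T2).

(** The polarised Jacobiator has no part that is pure in its last three slots. *)
Hypothesis type12 : forall v x y z,
  cyc2 T1 T2 v x y z + cyc2 T2 T1 v x y z =
    (cyc2 T1 T2 v (J x) (J y) z + cyc2 T2 T1 v (J x) (J y) z) +
    (cyc2 T1 T2 v (J x) y (J z) + cyc2 T2 T1 v (J x) y (J z)) +
    (cyc2 T1 T2 v x (J y) (J z) + cyc2 T2 T1 v x (J y) (J z)).

Let cyc2_last x y z w : cyc2 T1 T2 x y z w + cyc2 T2 T1 x y z w =
  - (cyc2 T1 T2 w x y z + cyc2 T2 T1 w x y z).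
Proof.
rewrite /cyc2 /contr2 -!big_split -sumrN; apply: eq_bigr => a _ /=.
rewrite !(form21_12 h1 _ w) !(form21_12 h2 _ w) (form21_12 h1 y x).
rewrite (form21_12 h2 y x) (form21_12 h1 z x) (form21_12 h2 z x); ring.
Qed.

(** The Jacobi identity of the complex brackets of T1 and T2, polarised, is the
    (3,1) part of the polarised Jacobiator. *)
Lemma jacobi_polar x y z w :
  comp2 (holo T1) (holo T2) x y z w + comp2 (holo T2) (holo T1) x y z w
  + (comp2 (holo T1) (holo T2) y z x w + comp2 (holo T2) (holo T1) y z x w)
  + (comp2 (holo T1) (holo T2) z x y w + comp2 (holo T2) (holo T1) z x y w) = 0.
Proof.
have := type12 w x y z.
have := cyc2_last x y z w; have := cyc2_last (J x) (J y) z w.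
have := cyc2_last (J x) y (J z) w; have := cyc2_last x (J y) (J z) w.
rewrite !comp2_holo // /cyc2.
lra.
Qed.

Definition trace (b : E -> E -> E -> R) x := \sum_c b (e c) x (e c).

(** The trace of [jacobi_polar] over its last two slots: the last two of the
    three cyclic terms cancel, as they are traces of products in either order. *)
Lemma trace_jacobi_polar x y :
  \sum_a (holo T1 x y (e a) * trace (holo T2) (e a)
          + holo T2 x y (e a) * trace (holo T1) (e a)) = 0.
Proof.
have hs : \sum_c (comp2 (holo T1) (holo T2) x y (e c) (e c)
    + comp2 (holo T2) (holo T1) x y (e c) (e c)
  + (comp2 (holo T1) (holo T2) y (e c) x (e c)
    + comp2 (holo T2) (holo T1) y (e c) x (e c))
  + (comp2 (holo T1) (holo T2) (e c) x y (e c)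
    + comp2 (holo T2) (holo T1) (e c) x y (e c))) = 0.
  by apply: big1 => c _; rewrite jacobi_polar.
have tr S1 S2 (k1 : form21 S1) (k2 : form21 S2) :
    \sum_c comp2 (holo S1) (holo S2) x y (e c) (e c) =
    - \sum_a holo S1 x y (e a) * trace (holo S2) (e a).
  rewrite exchange_big /= -sumrN; apply: eq_bigr => a _.
  rewrite -mulr_sumr -mulrN; congr (_ * _); rewrite -sumrN.
  by apply: eq_bigr => c _; rewrite (holo12 k2).
have cr S1 S2 (k1 : form21 S1) (k2 : form21 S2) :
    \sum_c comp2 (holo S2) (holo S1) (e c) x y (e c) =
    - \sum_c comp2 (holo S1) (holo S2) y (e c) x (e c).
  rewrite exchange_big /= -sumrN; apply: eq_bigr => a _.
  rewrite -sumrN; apply: eq_bigr => c _.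
  by rewrite (holo12 k1 y); ring.
move: hs; rewrite !big_split /= (tr _ _ h1 h2) (tr _ _ h2 h1).
rewrite (cr _ _ h1 h2) (cr _ _ h2 h1); lra.
Qed.
End Polar.

Lemma cyc2_form22 T1 T2 : form21 T1 -> form21 T2 ->
  let A x y z w := cyc2 T1 T2 x y z w + cyc2 T2 T1 x y z w in
  (forall v x y z, A v x y z =
    A v (J x) (J y) z + A v (J x) y (J z) + A v x (J y) (J z)) ->
  form22 A.
Proof.
move=> h1 h2 A tyA; split=> [v|]; last first.
  move=> v x y z; rewrite /A /cyc2 /contr2 -!big_split -sumrN.
  apply: eq_bigr => a _ /=.
  rewrite (form21_12 h1 v x) (form21_12 h2 v x) (form21_12 h1 v y).
  rewrite (form21_12 h2 v y) (form21_12 h1 y x) (form21_12 h2 y x); ring.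
split=> //.
- move=> x y a u w; rewrite /A /cyc2 /contr2 mulrDr.
  rewrite !mulrDr !mulr_sumr -!big_split; apply: eq_bigr => c _ /=.
  by rewrite !(form21_lin2 h1) !(form21_lin2 h2); ring.
- move=> x y z; rewrite /A /cyc2 /contr2 -!big_split -sumrN.
  apply: eq_bigr => a _ /=.
  rewrite (form21_12 h1 v x) (form21_12 h2 v x) (form21_12 h1 v y).
  rewrite (form21_12 h2 v y) (form21_12 h1 y x) (form21_12 h2 y x); ring.
- move=> x y z; rewrite /A /cyc2 /contr2 -!big_split -sumrN.
  apply: eq_bigr => a _ /=.
  rewrite (form21_12 h1 z y) (form21_12 h2 z y) (form21_12 h1 z v).
  rewrite (form21_12 h2 z v) (form21_12 h1 y v) (form21_12 h2 y v); ring.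
Qed.

Variable T : E -> E -> E -> R.
Hypothesis hT : form21 T.
Let sig := cyc2 T T.
Hypothesis sig_type : forall v x y z, sig v x y z =
  sig v (J x) (J y) z + sig v (J x) y (J z) + sig v x (J y) (J z).

Let hsig : form22 sig.
Proof.
have h := @cyc2_form22 T T hT hT; move: h => /= h.
have {}h : form22 (fun x y z w => sig x y z w + sig x y z w).
  by apply: h => v x y z; rewrite -!/sig; have := sig_type v x y z; lra.
case: h => [h1 h2]; split=> [v|v x y z]; last by have := h2 v x y z; lra.
case: (h1 v) => k1 k2 k3 k4; split=> // [x y a u w|x y z|x y z].
- have := k1 x y a u w; lra.
- have := k2 x y z; lra.
- have := k3 x y z; lra.
Qed.
Let sig21 v : form21 (sig v) := form22_form21 hsig v.

(** When the covariant derivative of [T] in the direction [q] is minus a third of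
    [sig q], this is minus three times the covariant derivative of [sig]. *)
Let C q x y z w := cyc2 T (sig q) x y z w + cyc2 (sig q) T x y z w.
Hypothesis C_type : forall q v x y z, C q v x y z =
  C q v (J x) (J y) z + C q v (J x) y (J z) + C q v x (J y) (J z).
Hypothesis ricci_id : forall x y z u v,
  C x y z u v - C y x z u v = 3 * \sum_a T x y (e a) * sig (e a) z u v.

Let hC q : form22 (C q).
Proof. exact: cyc2_form22 (hT) (sig21 q) (C_type q). Qed.

Let b := holo T.
Let s := mixed sig.

Let b_tau x y : \sum_a b x y (e a) * trace b (e a) = 0.
Proof.
have hty : forall v x y z,
  cyc2 T T v x y z + cyc2 T T v x y z =
    (cyc2 T T v (J x) (J y) z + cyc2 T T v (J x) (J y) z) +
    (cyc2 T T v (J x) y (J z) + cyc2 T T v (J x) y (J z)) +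
    (cyc2 T T v x (J y) (J z) + cyc2 T T v x (J y) (J z)).
  by move=> v {}x {}y z; have := sig_type v x y z; rewrite /sig; lra.
have := trace_jacobi_polar hT hT hty x y.
by rewrite big_split /=; rewrite -/b; lra.
Qed.

Let ric x y := \sum_c s (e c) x (e c) y.

(* The (2,1) part of the derivative of [T] is thus a multiple of [s], and
   [trace_jacobi_polar] for the pair of [T] and [sig q] relates [s] to [b]. *)
Let holo_sig q x y z : holo (sig q) x y z = s x y q z.
Proof.
rewrite /holo /s /mixed.
by rewrite !(form22_23 hsig _ q) !(form22_12 hsig _ q); ring.
Qed.

Let s_tau x y q : \sum_a s x y q (e a) * trace b (e a) =
  \sum_a b x y (e a) * ric (e a) q.
Proof.
have hty : forall v x y z, C q v x y z =
    (cyc2 T (sig q) v (J x) (J y) z + cyc2 (sig q) T v (J x) (J y) z) +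
    (cyc2 T (sig q) v (J x) y (J z) + cyc2 (sig q) T v (J x) y (J z)) +
    (cyc2 T (sig q) v x (J y) (J z) + cyc2 (sig q) T v x (J y) (J z)).
  by move=> v {}x {}y z; rewrite C_type.
have := trace_jacobi_polar hT (sig21 q) hty x y.
rewrite big_split /= addrC -/b => /eqP; rewrite addr_eq0 => /eqP h.
transitivity (\sum_a holo (sig q) x y (e a) * trace b (e a)).
  by apply: eq_bigr => a _; rewrite holo_sig.
rewrite h -sumrN; apply: eq_bigr => a _.
rewrite /trace /ric -mulrN; congr (_ * _); rewrite -sumrN.
by apply: eq_bigr => c _; rewrite holo_sig /s (mixed34 hsig) opprK.
Qed.

Let s_J34 x y k l : s x y (J k) l = s x y k (J l).
Proof. exact: mixed_J34. Qed.

(** The Ricci identity in the directions [x] and [y], restricted to the part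
    where [y] and [v] have opposite types.  In the contraction with [s] the basis
    vector has then the type of [y] in [T], which leaves only the component [b]
    with its antilinear slot at [x]. *)
Let bs_C x y z u v : 12 * \sum_a b y (e a) x * s z u (e a) v =
  2 * (mixed (C x) z u y v - mixed (C y) z u x v
  + mixed (C x) z u (J y) (J v) - mixed (C (J y)) z u x (J v)).
Proof.
have e1 : \sum_a b y (e a) x * s z u (e a) v =
    2^-1 * (\sum_a T x y (e a) * s z u (e a) v
            + \sum_a T x (J y) (e a) * s z u (e a) (J v)).
  have -> : \sum_a T x (J y) (e a) * s z u (e a) (J v) =
       - \sum_a T x (J y) (J (e a)) * s z u (e a) v.
    rewrite (trace_J (form21_lin hT _ _)
      (mixed_lin3 hsig z u v)) opprK.
    by apply: eq_bigr => a _; rewrite -/s s_J34.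
  rewrite -sumrB mulr_sumr; apply: eq_bigr => a _.
  by rewrite /b /holo -!(form21_rot hT x) ; ring.
have e2 p w : 3 * \sum_a T x p (e a) * s z u (e a) w =
    mixed (C x) z u p w - mixed (C p) z u x w.
  have -> : 3 * \sum_a T x p (e a) * s z u (e a) w =
     2^-1 * (3 * (\sum_a T x p (e a) * sig (e a) z u w)
         - 3 * (\sum_a T x p (e a) * sig (e a) (J z) (J u) w)).
    rewrite !mulr_sumr -sumrB mulr_sumr; apply: eq_bigr => a _.
    rewrite /s /mixed !(form22_23 hsig _ (e a)) !(form22_12 hsig _ (e a)).
    ring.
  have mv q p' z' : C q p' z' u w = C q z' u p' w.
    by rewrite (form22_12 (hC q) z') (form22_23 (hC q) z' u) opprK.
  have mv' q p' : C q p' (J z) (J u) w = C q (J z) (J u) p' w.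
    by rewrite (form22_12 (hC q) (J z)) (form22_23 (hC q) (J z) (J u)) opprK.
  rewrite -!ricci_id /mixed (mv x p z) (mv p x z) (mv' x p) (mv' p x).
  ring.
have := e2 y v; have := e2 (J y) (J v); rewrite e1; lra.
Qed.

(** In [bs_C] the derivatives in the direction [x] cancel, because there [y] and
    [v] occupy two slots of equal type; those in the directions [y] and J(y) are
    skew in [x] and [v]. *)
Let bs_skew x y z u v :
  \sum_a b y (e a) x * s z u (e a) v = - \sum_a b y (e a) v * s z u (e a) x.
Proof.
have := bs_C x y z u v; have := bs_C v y z u x.
rewrite !(mixed_JJ (hC _)) -[mixed (C (J y)) z u v (J x)](mixed_J34 (hC _)).
rewrite [mixed (C (J y)) z u (J v) x](mixed34 (hC _)) (mixed34 (hC y) z u x v).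
lra.
Qed.

Let contr2E x y k l : contr2 T T x y k l = \sum_a
  (b x y (e a) + b y (e a) x - b x (e a) y)
  * (b k l (e a) + b l (e a) k - b k (e a) l).
Proof.
apply: eq_bigr => a _; rewrite !(holo_sum hT _ _ (e a)).
by rewrite (holo12 hT x (e a)) (holo12 hT k (e a)).
Qed.

(** Only the products in which [x] and [y] have the same type survive. *)
Let contr2_mixed y k x l :
  contr2 T T y k x l - contr2 T T (J y) k (J x) l = - 2 * \sum_a
  ((b y k (e a) + b k (e a) y) * b x (e a) l
   + b y (e a) k * (b x l (e a) + b l (e a) x)).
Proof.
pose f y k c := - b y k c - b k c y - b y c k.
have hf y' k' : lin (f y' k').
  move=> a u w; rewrite /f /b !(holo_lin3 hT) !(holo_lin2 hT); ring.
have -> : contr2 T T (J y) k (J x) l = \sum_a f y k (e a) * f x l (e a).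
  rewrite -(trace_JJ (hf y k) (hf x l)) contr2E.
  apply: eq_bigr => a _; rewrite /f /b.
  rewrite (holo_J13 hT y k) (holo_J13 hT x l).
  rewrite (holo_J12 hT y (e a)) (holo_J12 hT x (e a)).
  rewrite (holo_J23 hT k (e a)) (holo_J23 hT l (e a)); ring.
rewrite contr2E -sumrB mulr_sumr; apply: eq_bigr => a _; rewrite /f; ring.
Qed.

(** The definition of [s] expanded in [b] contains in addition two Jacobi
    expressions of [b], which vanish. *)
Let s_quad x y k l : s x y k l = \sum_a
  (b x y (e a) * b k l (e a) - b (e a) y k * b (e a) l x
   - b (e a) k y * b (e a) x l + b (e a) x k * b (e a) l y
   + b (e a) k x * b (e a) y l).
Proof.
have hty : forall v x y z,
  cyc2 T T v x y z + cyc2 T T v x y z =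
    (cyc2 T T v (J x) (J y) z + cyc2 T T v (J x) (J y) z) +
    (cyc2 T T v (J x) y (J z) + cyc2 T T v (J x) y (J z)) +
    (cyc2 T T v x (J y) (J z) + cyc2 T T v x (J y) (J z)).
  by move=> v {}x {}y z; have := sig_type v x y z; rewrite /sig; lra.
have jac p w : comp2 b b x y p w + comp2 b b y p x w
    + comp2 b b p x y w = 0.
  have := jacobi_polar hT hT hty x y p w.
  by rewrite -/b; lra.
have e1 : contr2 T T x y k l - contr2 T T (J x) (J y) k l =
    2 * \sum_a b x y (e a) * (b k l (e a) + b l (e a) k - b k (e a) l).
  rewrite /contr2 -sumrB mulr_sumr; apply: eq_bigr => a _.
  have -> : b k l (e a) + b l (e a) k - b k (e a) l = T k l (e a).
    by rewrite (holo_sum hT k l (e a)) (holo12 hT k (e a)).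
  by rewrite /b /holo; lra.
have e3 : contr2 T T k x y l - contr2 T T k (J x) (J y) l =
    - (contr2 T T x k y l - contr2 T T (J x) k (J y) l).
  rewrite /contr2 -!sumrB -sumrN; apply: eq_bigr => a _.
  by rewrite (form21_12 hT x k) (form21_12 hT (J x) k); ring.
transitivity (2^-1 * ((contr2 T T x y k l - contr2 T T (J x) (J y) k l)
  + (contr2 T T y k x l - contr2 T T (J y) k (J x) l)
  + (contr2 T T k x y l - contr2 T T k (J x) (J y) l))).
  by rewrite /s /mixed /sig /cyc2; ring.
rewrite e3 e1 !contr2_mixed.
set a1 := \sum_a _; set a2 := \sum_a _; set a3 := \sum_a _.
transitivity (a1 - a2 + a3
  + (comp2 b b x y l k + comp2 b b y l x k + comp2 b b l x y k)
  - (comp2 b b x y k l + comp2 b b y k x l + comp2 b b k x y l)).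
  by rewrite !jac; lra.
rewrite /a1 /a2 /a3 /comp2 -!big_split -!sumrB -!big_split -sumrB.
apply: eq_bigr => a _ /=.
have b12 p q w : b q p w = - b p q w by exact: holo12.
rewrite !(b12 k (e a)) !(b12 l (e a)) !(b12 x (e a)) !(b12 y (e a)).
rewrite (b12 x l) (b12 x k); ring.
Qed.

Let sig_basis i j k l : sig (e i) (e j) (e k) (e l) = 0.
Proof.
have h := @contraction_vanishing R I (fun i j k => b (e i) (e j) (e k))
  (fun i j k l => s (e i) (e j) (e k) (e l)).
have s0 : forall i j k l, s (e i) (e j) (e k) (e l) = 0.
  apply: h => *.
  - exact: holo12.
  - exact: mixed12.
  - exact: mixed_pair.
  - exact: b_tau.
  - exact: s_tau.
  - exact: bs_skew.
  - exact: s_quad.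
by rewrite (mixed_sum hsig) -/s !s0 !addr0.
Qed.

(** Being of type (2,2), [sig] is determined by its component [s], to whose
    values on the basis [contraction_vanishing] applies. *)
Lemma torsion_square_eq0 x y z w : sig x y z w = 0.
Proof.
have rot p q u v : sig p q u v = - sig q u v p.
  by rewrite (form22_rot hsig p) opprK.
have step p q u : (forall a, sig p q u (e a) = 0) -> forall v, sig p q u v = 0.
  move=> h v; rewrite (lin_expand v (form21_lin (sig21 p) q u)).
  by apply: big1 => a _; rewrite h mulr0.
apply: (step _ _ _) => i; rewrite rot -[RHS]oppr0; congr (- _); move: x.
apply: (step _ _ _) => j; rewrite rot -[RHS]oppr0; congr (- _); move: y.
apply: (step _ _ _) => k; rewrite rot -[RHS]oppr0; congr (- _); move: z.
apply: (step _ _ _) => l; exact: sig_basis.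
Qed.

End Traces.
End HermitianAlgebra.

(** * Orthonormal bases of a positive definite matrix *)
Section Orthonormal.
Context (R : rcfType) (N : nat) (G : 'M[R]_N).
Hypothesis G_sym : G^T = G.
Hypothesis G_pos : forall u : 'rV_N, u != 0 -> 0 < (u *m G *m u^T) 0 0.

(** Gram-Schmidt without projections: as long as there are fewer rows than
    dimensions, some nonzero vector is orthogonal to all of them. *)
Lemma orthonormal_rows k : (k <= N)%N ->
  exists M : 'M[R]_(k, N), M *m G *m M^T = 1%:M.
Proof.
elim: k => [|k IH] kN; first by exists 0; apply/matrixP => -[].
have [M hM] := IH (ltnW kN).
have /rowV0Pn[u uK u0] : kermx (G *m M^T) != 0.
  rewrite kermx_eq0 /row_free neq_ltn; apply/orP; left.
  exact: leq_ltn_trans (rank_leq_col _) kN.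
move: uK => /sub_kermxP; rewrite mulmxA => uM.
have Mu : M *m G *m u^T = 0.
  by apply: trmx_inj; rewrite !trmx_mul trmxK G_sym mulmxA uM trmx0.
have d0 := G_pos u0; set d := (u *m G *m u^T) 0 0 in d0.
pose w := (Num.sqrt d)^-1 *: u.
rewrite -[k.+1]addn1; exists (col_mx M w).
have wT : w^T = (Num.sqrt d)^-1 *: u^T by rewrite /w linearZ.
have ww : w *m G *m w^T = 1%:M.
  rewrite wT /w -!scalemxAl -scalemxAr (mx11_scalar (u *m G *m u^T)) -/d.
  rewrite -scalemx1 !scalerA -invfM -expr2.
  by rewrite sqr_sqrtr ?ltW // mulVf ?gt_eqF // scale1r.
have wM : w *m G *m M^T = 0 by rewrite /w -!scalemxAl uM scaler0.
have Mw : M *m G *m w^T = 0 by rewrite wT -scalemxAr Mu scaler0.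
rewrite tr_col_mx mul_col_mx mul_col_row hM ww wM Mw.
by rewrite scalar_mx_block.
Qed.

Lemma orthonormal_basis : exists e : 'I_N -> 'rV[R]_N,
  forall x, x = \sum_a (x *m G *m (e a)^T) 0 0 *: e a.
Proof.
have [M hM] := orthonormal_rows (leqnn N).
exists (fun a => row a M) => x.
have h : G *m M^T *m M = 1%:M by apply: mulmx1C; rewrite mulmxA.
rewrite -{1}[x]mulmx1 -h mulmxA mulmx_sum_row mulmxA; apply: eq_bigr => a _.
by congr (_ *: _); rewrite !mxE; apply: eq_bigr => j _; rewrite !mxE.
Qed.
End Orthonormal.

(** * Derivatives of matrix-valued maps *)
Section Calculus.
Context (R : realType).

Lemma is_derive_mxP (V : normedModType R) p q (M : V -> 'M[R]_(p, q)) dM x v :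
  is_derive x v M dM <-> forall i j, is_derive x v (fun y => M y i j) (dM i j).
Proof.
split=> [[h <-] i j|h].
  split; first by move/derivable_mxP: h; apply.
  by rewrite derive_mx // mxE.
have hM : derivable M x v by apply/derivable_mxP => i j; case: (h i j).
split=> //; rewrite derive_mx //; apply/matrixP => i j; rewrite mxE.
by case: (h i j).
Qed.

Lemma is_derive_sumE (V : normedModType R) (W : normedModType R) k
  (h : 'I_k -> V -> W) dh x v : (forall i, is_derive x v (h i) (dh i)) ->
  is_derive x v (fun y => \sum_i h i y) (\sum_i dh i).
Proof.
move=> hh; rewrite (_ : (fun y => _) = \sum_i h i); first exact: is_derive_sum.
by apply/funext => y; rewrite fct_sumE.
Qed.

Lemma is_derive_mulmx (V : normedModType R) p q r (A : V -> 'M[R]_(p, q))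
  (B : V -> 'M[R]_(q, r)) dA dB x v :
  is_derive x v A dA -> is_derive x v B dB ->
  is_derive x v (fun y => A y *m B y) (dA *m B x + A x *m dB).
Proof.
move=> /is_derive_mxP hA /is_derive_mxP hB; apply/is_derive_mxP => i j.
rewrite (_ : (fun y => _) = fun y => \sum_k A y i k * B y k j); last first.
  by apply/funext => y; rewrite mxE.
rewrite !mxE -big_split /=; apply: is_derive_sumE => k.
apply: is_derive_eq (is_deriveM (hA i k) (hB k j)) _.
by rewrite addrC; congr (_ + _); exact: mulrC.
Qed.

Lemma is_derive_trmx (V : normedModType R) p q (A : V -> 'M[R]_(p, q)) dA x v :
  is_derive x v A dA -> is_derive x v (fun y => (A y)^T) dA^T.
Proof.
move=> /is_derive_mxP hA; apply/is_derive_mxP => i j.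
rewrite (_ : (fun y => _) = fun y => A y j i) ?mxE //.
by apply/funext => y; rewrite mxE.
Qed.

Lemma is_derive_bilin (V : normedModType R) m (G : V -> 'M[R]_(m + m)) dG
  (A B : V -> cvec R m) dA dB x v :
  is_derive x v G dG -> is_derive x v A dA -> is_derive x v B dB ->
  is_derive x v (fun y => bilin (G y) (A y) (B y))
    (bilin dG (A x) (B x) + bilin (G x) dA (B x) + bilin (G x) (A x) dB).
Proof.
move=> hG hA hB.
have := is_derive_mulmx (is_derive_mulmx hA hG) (is_derive_trmx hB).
move=> /is_derive_mxP/(_ 0 0) h; apply: is_derive_eq h _.
by rewrite /bilin !mulmxDl !mxE; ring.
Qed.

Lemma is_derive_near_unique (V W : normedModType R) (f h : V -> W) df dh x v :
  is_derive x v f df -> is_derive x v h dh -> (\near x, f x = h x) -> df = dh.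
Proof.
move=> [_ <-] [_ <-]; exact: near_eq_derive.
Qed.

End Calculus.

(** * The complex structure and Christoffel symbols as bilinear maps *)
Section Bilinear.
Context (R : realType) (m : nat).
Implicit Types (M : 'M[R]_(m + m)) (u v w : cvec R m).

Lemma bilinPl M v a u w : bilin M (a *: u + w) v = a * bilin M u v + bilin M w v.
Proof. by rewrite /bilin !mulmxDl -!scalemxAl !mxE. Qed.
Lemma bilinPr M v a u w : bilin M v (a *: u + w) = a * bilin M v u + bilin M v w.
Proof.
rewrite /bilin; have -> : (a *: u + w)^T = a *: u^T + w^T by rewrite linearP.
by rewrite mulmxDr -scalemxAr !mxE.
Qed.
Lemma bilinDl M v u w : bilin M (u + w) v = bilin M u v + bilin M w v.
Proof. by rewrite -[u]scale1r bilinPl mul1r scale1r. Qed.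
Lemma bilinDr M v u w : bilin M v (u + w) = bilin M v u + bilin M v w.
Proof. by rewrite -[u]scale1r bilinPr mul1r scale1r. Qed.
Lemma bilin0l M v : bilin M 0 v = 0.
Proof. by rewrite /bilin !mul0mx mxE. Qed.
Lemma bilin0r M v : bilin M v 0 = 0.
Proof. by rewrite /bilin trmx0 mulmx0 mxE. Qed.
Lemma bilinZl M v a u : bilin M (a *: u) v = a * bilin M u v.
Proof. by rewrite -[a *: u]addr0 bilinPl bilin0l addr0. Qed.
Lemma bilinZr M v a u : bilin M v (a *: u) = a * bilin M v u.
Proof. by rewrite -[a *: u]addr0 bilinPr bilin0r addr0. Qed.
Lemma bilinNl M v u : bilin M (- u) v = - bilin M u v.
Proof. by rewrite -scaleN1r bilinZl mulN1r. Qed.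
Lemma bilinNr M v u : bilin M v (- u) = - bilin M v u.
Proof. by rewrite -scaleN1r bilinZr mulN1r. Qed.
Lemma bilinBl M v u w : bilin M (u - w) v = bilin M u v - bilin M w v.
Proof. by rewrite bilinDl bilinNl. Qed.

Lemma bilin_inj M u w : (forall v, v != 0 -> 0 < bilin M v v) ->
  (forall z, bilin M u z = bilin M w z) -> u = w.
Proof.
move=> pos h; apply/eqP; rewrite -subr_eq0; apply/negP => /negP /pos.
by rewrite bilinBl h subrr ltxx.
Qed.

Lemma JstP a u v : Jst (a *: u + v) = a *: Jst u + Jst v :> cvec R m.
Proof.
rewrite /Jst.
have -> : rsubmx (a *: u + v) = a *: rsubmx u + rsubmx v by exact: linearP.
have -> : lsubmx (a *: u + v) = a *: lsubmx u + lsubmx v by exact: linearP.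
by rewrite opprD -scalerN scale_row_mx add_row_mx.
Qed.
Lemma JstK u : Jst (Jst u) = - u.
Proof. by rewrite /Jst row_mxKl row_mxKr -opp_row_mx hsubmxK. Qed.
Lemma JstD u v : Jst (u + v) = Jst u + Jst v.
Proof. by rewrite -[u]scale1r JstP !scale1r. Qed.
Lemma JstN u : Jst (- u) = - Jst u.
Proof. by rewrite -[in LHS](JstK u) JstK. Qed.
Lemma JstZ a u : Jst (a *: u) = a *: Jst u.
Proof.
have J0 : Jst (0 : cvec R m) = 0 by rewrite /Jst !linear0 row_mx0.
by rewrite -[a *: u]addr0 JstP J0 addr0.
Qed.

Lemma Jst_mulmx u : Jst u = u *m block_mx 0 1%:M (- 1%:M) 0.
Proof.
rewrite -[in RHS](hsubmxK u) mul_row_block !mulmx0 !mulmx1 mulmxN mulmx1.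
by rewrite add0r addr0.
Qed.

Lemma rowDE u v i : (u + v) 0 i = u 0 i + v 0 i. Proof. exact: mxE. Qed.
Lemma rowNE u i : (- u) 0 i = - u 0 i. Proof. exact: mxE. Qed.
Lemma rowZE a u i : (a *: u) 0 i = a * u 0 i. Proof. exact: mxE. Qed.
Lemma row0E i : (0 : cvec R m) 0 i = 0. Proof. exact: mxE. Qed.

Definition chris (G : 'I_(m + m) -> 'M[R]_(m + m)) u v : cvec R m :=
  \row_k bilin (G k) u v.

Variable G : 'I_(m + m) -> 'M[R]_(m + m).
Lemma chrisPl v a u w : chris G (a *: u + w) v = a *: chris G u v + chris G w v.
Proof. by apply/rowP => i; rewrite !mxE bilinPl. Qed.
Lemma chrisPr v a u w : chris G v (a *: u + w) = a *: chris G v u + chris G v w.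
Proof. by apply/rowP => i; rewrite !mxE bilinPr. Qed.
Lemma chrisDl v u w : chris G (u + w) v = chris G u v + chris G w v.
Proof. by apply/rowP => i; rewrite !mxE bilinDl. Qed.
Lemma chrisDr v u w : chris G v (u + w) = chris G v u + chris G v w.
Proof. by apply/rowP => i; rewrite !mxE bilinDr. Qed.
Lemma chris0l v : chris G 0 v = 0.
Proof. by apply/rowP => i; rewrite !mxE bilin0l. Qed.
Lemma chris0r v : chris G v 0 = 0.
Proof. by apply/rowP => i; rewrite !mxE bilin0r. Qed.
Lemma chrisZl v a u : chris G (a *: u) v = a *: chris G u v.
Proof. by apply/rowP => i; rewrite !mxE bilinZl. Qed.
Lemma chrisZr v a u : chris G v (a *: u) = a *: chris G v u.
Proof. by apply/rowP => i; rewrite !mxE bilinZr. Qed.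
Lemma chrisNl v u : chris G (- u) v = - chris G u v.
Proof. by apply/rowP => i; rewrite !mxE bilinNl. Qed.
Lemma chrisNr v u : chris G v (- u) = - chris G v u.
Proof. by apply/rowP => i; rewrite !mxE bilinNr. Qed.
End Bilinear.

Lemma is_derive_Jst (R : realType) (V : normedModType R) m (W : V -> cvec R m)
  dW x v : is_derive x v W dW -> is_derive x v (fun y => Jst (W y)) (Jst dW).
Proof.
move=> h; under eq_fun do rewrite Jst_mulmx.
apply: is_derive_eq (is_derive_mulmx h (is_derive_cst _ _ _)) _.
by rewrite mulmx0 addr0 Jst_mulmx.
Qed.

Lemma eq_subr (V : zmodType) (a b x y : V) : a = b -> x - y = a - b -> x = y.
Proof. by move=> ->; rewrite subrr => /eqP; rewrite subr_eq0 => /eqP. Qed.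

(** Atoms are named before normalising, so that the decision procedures do not
    compare them by unfolding. *)
Ltac coordinate_ring := apply/rowP => ?; rewrite !(rowDE, rowNE, rowZE, row0E);
  repeat match goal with
  | |- context [?t] => match t with @fun_of_matrix _ _ _ _ _ _ =>
      generalize t; intro end
  end; by field; rewrite ?pnatr_eq0.
Ltac scalar_lra := repeat match goal with
  | |- context [?t] => match t with @bilin _ _ _ _ _ => generalize t; intro end
  end; lra.

(** * The torsion of a flat connection with skew torsion *)
Section Chart.
Context (R : realType) (m : nat).
Local Notation E := (cvec R m).
Local Notation J := (@Jst R m).
Variables (U : set E) (G : E -> 'M[R]_(m + m))
  (Ga : E -> 'I_(m + m) -> 'M[R]_(m + m)).
Local Notation gm x := (bilin (G x)).
Local Notation Gam x := (chris (Ga x)).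

Definition covd (v : E) (W : E -> E) (x : E) : E := 'D_v W x + Gam x v (W x).
(** The torsion and the tensors built from it are locked: comparing two of them
    by conversion would expand them into Christoffel symbols. *)
Fact Tor_key : unit. Proof. exact: tt. Qed.
Definition Tor x u v : E := locked_with Tor_key (Gam x u v - Gam x v u).
Lemma Tor_def x u v : Tor x u v = Gam x u v - Gam x v u.
Proof. exact: locked_withE. Qed.
Definition Jac x u v w : E := locked_with Tor_key
  (Tor x (Tor x u v) w + Tor x (Tor x v w) u + Tor x (Tor x w u) v).
Lemma Jac_def x u v w : Jac x u v w =
  Tor x (Tor x u v) w + Tor x (Tor x v w) u + Tor x (Tor x w u) v.
Proof. exact: locked_withE. Qed.

(** The facts about the Strominger-Bismut connection in one chart from which
    everything follows.  [ch_flat1] and [ch_flat2] say that the curvature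
    annihilates constant fields and the fields T(w,z) for constant [w], [z]; the
    bracket of two constant fields being zero, it is the commutator of the
    covariant derivatives. *)
Record bismut_flat_chart : Prop := BismutFlatChart {
  ch_open : open U;
  ch_G_der : forall x v, U x -> derivable G x v;
  ch_Ga_der : forall x v k, U x -> derivable (Ga ^~ k) x v;
  ch_sym : forall x u v, U x -> gm x u v = gm x v u;
  ch_pos : forall x u, U x -> u != 0 -> 0 < gm x u u;
  ch_gJ : forall x u v, U x -> gm x (J u) (J v) = gm x u v;
  ch_metric : forall x u v w, U x ->
    'D_u (fun q => gm q v w) x = gm x (Gam x u v) w + gm x v (Gam x u w);
  ch_complex : forall x u v, U x -> Gam x u (J v) = J (Gam x u v);
  ch_skew : forall x u v w, U x -> gm x (Tor x u v) w = - gm x (Tor x u w) v;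
  ch_torsion : forall x u v w, U x -> gm x (Tor x u v) w =
    - ('D_(J u) (fun q => gm q v (J w)) x - 'D_(J v) (fun q => gm q u (J w)) x
       + 'D_(J w) (fun q => gm q u (J v)) x);
  ch_flat1 : forall x u v w, U x ->
    covd u (fun q => Gam q v w) x = covd v (fun q => Gam q u w) x;
  ch_flat2 : forall x u v w z, U x ->
    covd u (covd v (fun q => Tor q w z)) x =
    covd v (covd u (fun q => Tor q w z)) x }.

Hypothesis ch : bismut_flat_chart.

Lemma chart_near x : U x -> \near x, U x.
Proof. by move=> Ux; apply: open_nbhs_nbhs; split=> //; exact: ch_open ch. Qed.

(** The relational form of [covd], for which the Leibniz rules need no separate
    hypotheses of differentiability. *)
Definition is_covd x v (W : E -> E) (d : E) : Prop :=
  is_derive x v W (d - Gam x v (W x)).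

Lemma is_covd_covd x v W d : is_covd x v W d -> covd v W x = d.
Proof. by case=> _ h; rewrite /covd h subrK. Qed.

Lemma is_covd_der x v W : derivable W x v -> is_covd x v W (covd v W x).
Proof. by move=> /derivableP; rewrite /is_covd /covd addrK. Qed.

Lemma is_covd_eq x v W d d' : is_covd x v W d -> d = d' -> is_covd x v W d'.
Proof. by move=> ? <-. Qed.

Lemma is_covd_cst x v w : is_covd x v (cst w) (Gam x v w).
Proof. by rewrite /is_covd subrr; exact: is_derive_cst. Qed.

Lemma is_covdD x v W1 W2 d1 d2 : is_covd x v W1 d1 -> is_covd x v W2 d2 ->
  is_covd x v (fun q => W1 q + W2 q) (d1 + d2).
Proof.
move=> h1 h2; apply: is_derive_eq (is_deriveD h1 h2) _.
by rewrite chrisDr opprD addrACA.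
Qed.

Lemma is_covdN x v W d : is_covd x v W d -> is_covd x v (fun q => - W q) (- d).
Proof.
by move=> h; apply: is_derive_eq (is_deriveN h) _; rewrite chrisNr opprB opprK addrC.
Qed.

Lemma is_covdB x v W1 W2 d1 d2 : is_covd x v W1 d1 -> is_covd x v W2 d2 ->
  is_covd x v (fun q => W1 q - W2 q) (d1 - d2).
Proof. by move=> h1 h2; apply: is_covdD => //; exact: is_covdN. Qed.

Lemma is_covdZ a x v W d : is_covd x v W d -> is_covd x v (fun q => a *: W q) (a *: d).
Proof.
by move=> h; apply: is_derive_eq (is_deriveZ a h) _; rewrite chrisZr scalerBr.
Qed.

Lemma is_covdJ x v W d : U x -> is_covd x v W d -> is_covd x v (fun q => J (W q)) (J d).
Proof.
move=> Ux h; apply: is_derive_eq (is_derive_Jst h) _.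
by rewrite JstD JstN (ch_complex ch).
Qed.

Lemma covd_near x v W W' : U x -> (forall q, U q -> W q = W' q) ->
  covd v W x = covd v W' x.
Proof.
move=> Ux WW'; rewrite /covd (WW' x Ux); congr (_ + _); apply: near_eq_derive.
by near=> q; apply: WW'; near: q; exact: chart_near.
Unshelve. all: by end_near. Qed.

Lemma is_covd_unique x v W W' d d' : U x -> (forall q, U q -> W q = W' q) ->
  is_covd x v W d -> is_covd x v W' d' -> d = d'.
Proof.
move=> Ux WW' h h'; have := covd_near v Ux WW'.
by rewrite (is_covd_covd h) (is_covd_covd h').
Qed.

Lemma is_derive_gm x v W1 W2 d1 d2 : U x -> is_covd x v W1 d1 -> is_covd x v W2 d2 ->
  is_derive x v (fun q => gm q (W1 q) (W2 q)) (gm x d1 (W2 x) + gm x (W1 x) d2).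
Proof.
move=> Ux h1 h2; have hG := derivableP (ch_G_der ch Ux : derivable G x v).
apply: is_derive_eq (is_derive_bilin hG h1 h2) _.
have [_ e] := is_derive_bilin hG (is_derive_cst (W1 x) x v)
  (is_derive_cst (W2 x) x v).
move: e; rewrite /cst (ch_metric ch) // bilin0l bilin0r !addr0 => <-.
by rewrite bilinBl !(bilinDr, bilinNr); ring.
Qed.

Lemma is_derive_Gam x v u w W1 W2 d1 d2 : U x ->
  is_derive x v W1 d1 -> is_derive x v W2 d2 -> W1 x = u -> W2 x = w ->
  is_derive x v (fun q => Gam q (W1 q) (W2 q))
    ('D_v (fun q => Gam q u w) x + Gam x d1 w + Gam x u d2).
Proof.
move=> Ux h1 h2 <- <-.
have key A1 A2 b1 b2 : is_derive x v A1 b1 -> is_derive x v A2 b2 ->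
    is_derive x v (fun q => Gam q (A1 q) (A2 q))
     (chris (fun k => 'D_v (Ga ^~ k) x) (A1 x) (A2 x) + Gam x b1 (A2 x)
      + Gam x (A1 x) b2).
  move=> k1 k2; apply/is_derive_mxP => i j; rewrite ord1.
  have hG := derivableP (ch_Ga_der ch Ux : derivable (Ga ^~ j) x v).
  rewrite (_ : (fun y => _) = fun y => bilin (Ga y j) (A1 y) (A2 y)).
    by apply: is_derive_eq (is_derive_bilin hG k1 k2) _; rewrite !mxE.
  by apply/funext => y; rewrite mxE.
have [_ e] := key _ _ _ _ (is_derive_cst (W1 x) x v) (is_derive_cst (W2 x) x v).
apply: is_derive_eq (key _ _ _ _ h1 h2) _; by move: e; rewrite /cst chris0l chris0r !addr0 => ->.
Qed.

Lemma Tor_fun (W1 W2 : E -> E) : (fun q => Tor q (W1 q) (W2 q)) =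
  (fun q => Gam q (W1 q) (W2 q)) - (fun q => Gam q (W2 q) (W1 q)).
Proof. by apply/funext => q; rewrite Tor_def. Qed.

Lemma TorC x u v : Tor x v u = - Tor x u v.
Proof. by rewrite !Tor_def opprB. Qed.
Lemma TorPr x v a u w : Tor x v (a *: u + w) = a *: Tor x v u + Tor x v w.
Proof.
by rewrite !Tor_def chrisPl chrisPr; coordinate_ring.
Qed.
Lemma TorDr x v u w : Tor x v (u + w) = Tor x v u + Tor x v w.
Proof. by rewrite -[u]scale1r TorPr !scale1r. Qed.
Lemma TorNr x v u : Tor x v (- u) = - Tor x v u.
Proof. by rewrite !Tor_def chrisNl chrisNr opprB opprK addrC. Qed.
Lemma TorZr x v a u : Tor x v (a *: u) = a *: Tor x v u.
Proof. by rewrite !Tor_def chrisZl chrisZr scalerBr. Qed.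
Lemma TorDl x v u w : Tor x (u + w) v = Tor x u v + Tor x w v.
Proof. by rewrite TorC TorDr opprD -!(TorC x v). Qed.
Lemma TorNl x v u : Tor x (- u) v = - Tor x u v.
Proof. by rewrite TorC TorNr -TorC. Qed.
Lemma TorZl x v a u : Tor x (a *: u) v = a *: Tor x u v.
Proof. by rewrite TorC TorZr -scalerN -TorC. Qed.
Definition TorE := (TorDl, TorDr, TorNl, TorNr, TorZl, TorZr).

Definition covTor x v y z : E := locked_with Tor_key
  (covd v (fun q => Tor q y z) x - Tor x (Gam x v y) z - Tor x y (Gam x v z)).
Lemma covTor_def x v y z : covTor x v y z =
  covd v (fun q => Tor q y z) x - Tor x (Gam x v y) z - Tor x y (Gam x v z).
Proof. exact: locked_withE. Qed.

Lemma Gam_der x v y z : U x -> derivable (fun q => Gam q y z) x v.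
Proof.
move=> Ux.
by have [] := is_derive_Gam Ux (is_derive_cst y x v) (is_derive_cst z x v)
  erefl erefl.
Qed.

Lemma is_covd_Tor x v W1 W2 d1 d2 : U x -> is_covd x v W1 d1 -> is_covd x v W2 d2 ->
  is_covd x v (fun q => Tor q (W1 q) (W2 q))
    (covTor x v (W1 x) (W2 x) + Tor x d1 (W2 x) + Tor x (W1 x) d2).
Proof.
move=> Ux h1 h2; have k1 := is_derive_Gam Ux h1 h2 erefl erefl.
have k2 := is_derive_Gam Ux h2 h1 erefl erefl.
rewrite /is_covd Tor_fun; apply: is_derive_eq (is_deriveB k1 k2) _.
rewrite covTor_def /covd Tor_fun.
rewrite deriveB; try exact: Gam_der.
rewrite !Tor_def !(chrisDl, chrisDr, chrisNl, chrisNr).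
set D1 := 'D_v (fun q => Gam q (W1 x) (W2 x)) x.
set D2 := 'D_v (fun q => Gam q (W2 x) (W1 x)) x.
coordinate_ring.
Qed.

(** The covariant derivative along [u] and [v] of the constant field [w]. *)
Definition cov2 x u v w :=
  locked_with Tor_key (covd u (fun q => Gam q v w) x).
Lemma cov2_def x u v w : cov2 x u v w = covd u (fun q => Gam q v w) x.
Proof. exact: locked_withE. Qed.

Lemma is_covd_Gam x u v w : U x -> is_covd x u (fun q => Gam q v w) (cov2 x u v w).
Proof. by move=> Ux; rewrite cov2_def; apply: is_covd_der; exact: Gam_der. Qed.

Lemma is_covd_Tor_cst x u v w : U x ->
  is_covd x u (fun q => Tor q v w) (cov2 x u v w - cov2 x u w v).
Proof.
move=> Ux; rewrite (Tor_fun (cst v) (cst w)); apply: is_covdB; exact: is_covd_Gam.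
Qed.

(** Flatness on constant fields. *)
Lemma cov2C x u v w : U x -> cov2 x v u w = cov2 x u v w.
Proof. by move=> Ux; rewrite !cov2_def (ch_flat1 ch). Qed.

Ltac vector_ring := repeat match goal with
  | |- context [?t] => match t with
    | @Tor _ _ _ => generalize t; intro
    | @covTor _ _ _ _ => generalize t; intro
    | @Jac _ _ _ _ => generalize t; intro
    | @Jst _ _ _ => generalize t; intro
    | @chris _ _ _ _ _ => generalize t; intro
    | @cov2 _ _ _ _ => generalize t; intro
    end
  end; coordinate_ring.

Lemma covTorE x u v w : U x -> covTor x u v w =
  cov2 x u v w - cov2 x u w v - Tor x (Gam x u v) w - Tor x v (Gam x u w).
Proof. by move=> Ux; rewrite covTor_def (is_covd_covd (is_covd_Tor_cst u v w Ux)). Qed.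

Lemma covTorC x u v w : U x -> covTor x u w v = - covTor x u v w.
Proof.
move=> Ux; rewrite !covTorE // (TorC _ (Gam x u v) w) (TorC _ (Gam x u w) v).
vector_ring.
Qed.

Lemma Tor_Tor x u v w :
  Tor x (Tor x u v) w = Tor x (Gam x u v) w - Tor x (Gam x v u) w.
Proof. by rewrite [Tor x u v]Tor_def TorDl TorNl. Qed.

(** The second derivatives of constant fields cancel by [cov2C]; the remaining
    terms, in which the torsion contains a Christoffel symbol, combine by
    [Tor_Tor]. *)
Lemma bianchi x u v w : U x ->
  covTor x u v w + covTor x v w u + covTor x w u v = - Jac x u v w.
Proof.
move=> Ux; rewrite !covTorE // Jac_def !Tor_Tor.
rewrite (cov2C u v w) // (cov2C v w u) // (cov2C u w v) //.
rewrite (TorC _ (Gam x u w) v) (TorC _ (Gam x v u) w).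
rewrite (TorC _ (Gam x w v) u).
vector_ring.
Qed.

(** Differentiating the skew symmetry of the torsion form, which the connection
    preserves along with the metric. *)
Lemma covTor_skew x u v w z : U x ->
  gm x (covTor x u v w) z = - gm x (covTor x u v z) w.
Proof.
move=> Ux.
have h a b : is_derive x u (fun q => gm q (Tor q v a) b)
    (gm x (covTor x u v a) b + gm x (Tor x (Gam x u v) a) b
     + gm x (Tor x v (Gam x u a)) b + gm x (Tor x v a) (Gam x u b)).
  apply: is_derive_eq (is_derive_gm Ux (is_covd_Tor Ux (is_covd_cst x u v)
    (is_covd_cst x u a)) (is_covd_cst x u b)) _.
  by rewrite -!bilinDl.
have e := is_derive_near_unique (is_deriveD (h w z) (h z w))
  (is_derive_cst (0 : R) x u).
have s a b c := ch_skew ch a b c Ux.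
have := s (Gam x u v) w z; have := s v (Gam x u w) z; have := s v (Gam x u z) w.
suff /e : \near x, gm x (Tor x v w) z + gm x (Tor x v z) w = 0 by scalar_lra.
near=> q; rewrite (ch_skew ch) ?addNr //; near: q; exact: chart_near.
Unshelve. all: by end_near. Qed.

Lemma gm_Tor_Tor x u v w z : U x ->
  gm x (Tor x (Tor x u v) w) z = gm x (Tor x u v) (Tor x w z).
Proof.
by move=> Ux; rewrite TorC bilinNl (ch_skew ch) // opprK (ch_sym ch).
Qed.

Lemma gm_Jac x u v w z : U x -> gm x (Jac x u v w) z =
  gm x (Tor x u v) (Tor x w z) + gm x (Tor x v w) (Tor x u z)
  + gm x (Tor x w u) (Tor x v z).
Proof.
move=> Ux; rewrite -!gm_Tor_Tor // Jac_def.
by rewrite (bilinDl _ _ (_ + _)) (bilinDl _ _ (Tor x _ w)).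
Qed.

(** The derivative of the torsion form is skew in its last three slots.  In
    its Bianchi identity, exchanging the last two arguments changes the sign of
    [Jac]; the two versions together show that the derivative is also skew in its
    direction, so that the three cyclic terms are equal. *)
Lemma covTor_Jac x u v w : U x -> covTor x u v w = - (3^-1 *: Jac x u v w).
Proof.
move=> Ux; apply: (bilin_inj (fun _ => ch_pos ch Ux)) => z; rewrite bilinNl bilinZl.
have B a b c d : gm x (covTor x a b c) d + gm x (covTor x b c a) d
    + gm x (covTor x c a b) d = - gm x (Jac x a b c) d.
  by rewrite -!bilinDl bianchi // bilinNl.
have C a b c d : gm x (covTor x a b c) d = - gm x (covTor x a c b) d.
  by rewrite covTorC // bilinNl.
have S a b c d := covTor_skew a b c d Ux.
have S2 a b c d : gm x (Jac x a b d) c = - gm x (Jac x a b c) d.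
  rewrite !gm_Jac //.
  rewrite (TorC _ d a) (TorC _ d c) (TorC _ a c) !bilinNr !bilinNl.
  rewrite (ch_sym ch (Tor x b d)) // (ch_sym ch (Tor x b c)) //.
  scalar_lra.
have F a b c d : gm x (covTor x a b c) d = - gm x (covTor x d b c) a.
  have := B b c a d; have := B b c d a; rewrite S2.
  have := S b c d a; have := C c d b a; have := S c b d a; have := C c b a d.
  scalar_lra.
have Z a b c d : gm x (covTor x b c a) d = gm x (covTor x a b c) d.
  by rewrite S F opprK S C opprK.
have := B u v w z; rewrite (Z u v w z) -(Z w u v z).
scalar_lra.
Qed.

(** The part of the torsion that this relation excludes is the Nijenhuis
    tensor; it vanishes since [J] is parallel and constant in the chart. *)
Lemma Tor_type x u v : U x ->
  Tor x u v = Tor x (J u) (J v) - J (Tor x (J u) v) - J (Tor x u (J v)).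
Proof.
move=> Ux; rewrite !Tor_def !(ch_complex ch) // !(JstD, JstN, JstK).
vector_ring.
Qed.

(** Covariant derivative of [Tor_type], as [J] is parallel. *)
Lemma covTor_type x u v w : U x -> covTor x u v w =
  covTor x u (J v) (J w) - J (covTor x u (J v) w) - J (covTor x u v (J w)).
Proof.
move=> Ux; have h a b := is_covd_Tor Ux (is_covd_cst x u a) (is_covd_cst x u b).
have := is_covd_unique Ux (fun q => @Tor_type q v w) (h v w)
  (is_covdB (is_covdB (h (J v) (J w)) (is_covdJ Ux (h (J v) w)))
    (is_covdJ Ux (h v (J w)))).
rewrite /cst !(ch_complex ch) // (Tor_type (Gam x u v)) // (Tor_type v) //.
rewrite !(JstD, JstN) => e; apply: (eq_subr e); vector_ring.
Qed.

(** [Jac] is a multiple of the derivative of [T], by [covTor_Jac]; that it has no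
    pure part is not visible from its definition. *)
Lemma Jac_type x u v w : U x -> Jac x u v w =
  Jac x u (J v) (J w) - J (Jac x u (J v) w) - J (Jac x u v (J w)).
Proof.
move=> Ux; have e a b c : Jac x a b c = -3 *: covTor x a b c.
  by rewrite covTor_Jac //; vector_ring.
by rewrite !e covTor_type // !JstZ; vector_ring.
Qed.

(** The covariant derivative of [Jac], which the Leibniz rule reduces to that of
    the torsion. *)
Definition covJac x v a b c := locked_with Tor_key (
  (covTor x v (Tor x a b) c + Tor x (covTor x v a b) c) +
  (covTor x v (Tor x b c) a + Tor x (covTor x v b c) a) +
  (covTor x v (Tor x c a) b + Tor x (covTor x v c a) b)).
Lemma covJac_def x v a b c : covJac x v a b c =
  (covTor x v (Tor x a b) c + Tor x (covTor x v a b) c) +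
  (covTor x v (Tor x b c) a + Tor x (covTor x v b c) a) +
  (covTor x v (Tor x c a) b + Tor x (covTor x v c a) b).
Proof. exact: locked_withE. Qed.

Lemma is_covd_Jac x v W1 W2 W3 d1 d2 d3 : U x ->
  is_covd x v W1 d1 -> is_covd x v W2 d2 -> is_covd x v W3 d3 ->
  is_covd x v (fun q => Jac q (W1 q) (W2 q) (W3 q))
    (covJac x v (W1 x) (W2 x) (W3 x) + Jac x d1 (W2 x) (W3 x)
     + Jac x (W1 x) d2 (W3 x) + Jac x (W1 x) (W2 x) d3).
Proof.
move=> Ux h1 h2 h3.
have k1 := is_covd_Tor Ux (is_covd_Tor Ux h1 h2) h3.
have k2 := is_covd_Tor Ux (is_covd_Tor Ux h2 h3) h1.
have k3 := is_covd_Tor Ux (is_covd_Tor Ux h3 h1) h2.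
rewrite (_ : (fun q => _) = fun q => Tor q (Tor q (W1 q) (W2 q)) (W3 q)
  + Tor q (Tor q (W2 q) (W3 q)) (W1 q) + Tor q (Tor q (W3 q) (W1 q)) (W2 q)).
  apply: is_covd_eq (is_covdD (is_covdD k1 k2) k3) _.
  by rewrite covJac_def !Jac_def !TorDl; vector_ring.
by apply/funext => q; rewrite Jac_def.
Qed.

Ltac vector_ring2 := repeat match goal with
  | |- context [?t] => match t with
    | @covJac _ _ _ _ _ => generalize t; intro end
  end; vector_ring.

Lemma covJac_type x u v w z : U x -> covJac x u v w z =
  covJac x u v (J w) (J z) - J (covJac x u v (J w) z) - J (covJac x u v w (J z)).
Proof.
move=> Ux.
have h a b := is_covd_Jac Ux (is_covd_cst x u v) (is_covd_cst x u a)
  (is_covd_cst x u b).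
have := is_covd_unique Ux (fun q => @Jac_type q v w z) (h w z)
  (is_covdB (is_covdB (h (J w) (J z)) (is_covdJ Ux (h (J w) z)))
    (is_covdJ Ux (h w (J z)))).
rewrite /cst !(ch_complex ch) // (Jac_type (Gam x u v)) //.
rewrite (Jac_type v (Gam x u w)) // (Jac_type v w (Gam x u z)) //.
rewrite !(JstD, JstN) => e; apply: (eq_subr e); vector_ring2.
Qed.

(** Second covariant derivatives of T(w,z) commute by flatness.  The first
    derivative is a multiple of [Jac] plus terms in which the constants [w], [z]
    are differentiated, and the torsion in the last summand comes from
    differentiating the direction of the first derivative. *)
Lemma ricci_Jac x u v w z : U x ->
  covJac x u v w z - covJac x v u w z + Jac x (Tor x u v) w z = 0.
Proof.
move=> Ux.
pose K b q := - (3^-1 *: Jac q b w z) + Tor q (Gam q b w) z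
  + Tor q w (Gam q b z).
have hK b q : U q -> covd b (fun q => Tor q w z) q = K b q.
  move=> Uq; rewrite /K -covTor_Jac //.
  exact: is_covd_covd (is_covd_Tor Uq (is_covd_cst q b w) (is_covd_cst q b z)).
have hKK a b : covd a (covd b (fun q => Tor q w z)) x =
    - (3^-1 *: (covJac x a b w z + Jac x (Gam x a b) w z
       + Jac x b (Gam x a w) z + Jac x b w (Gam x a z)))
    + (- (3^-1 *: Jac x a (Gam x b w) z) + Tor x (cov2 x a b w) z
       + Tor x (Gam x b w) (Gam x a z))
    + (- (3^-1 *: Jac x a w (Gam x b z)) + Tor x (Gam x a w) (Gam x b z)
       + Tor x w (cov2 x a b z)).
  rewrite (covd_near a Ux (hK b)); apply: is_covd_covd.
  rewrite -!covTor_Jac //.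
  have h1 := is_covd_Jac Ux (is_covd_cst x a b) (is_covd_cst x a w)
    (is_covd_cst x a z).
  have h2 := is_covd_Tor Ux (is_covd_Gam a b w Ux) (is_covd_cst x a z).
  have h3 := is_covd_Tor Ux (is_covd_cst x a w) (is_covd_Gam a b z Ux).
  exact: is_covdD (is_covdD (is_covdN (is_covdZ 3^-1 h1)) h2) h3.
(* The factor clears the coefficient -1/3 of [Jac] in [covTor_Jac]. *)
have := congr1 ( *:%R (-3)) (ch_flat2 ch u v w z Ux).
rewrite !hKK !(cov2C u v) // => e; apply: (eq_subr e).
have -> : Jac x (Tor x u v) w z =
    Jac x (Gam x u v) w z - Jac x (Gam x v u) w z.
  by rewrite [Tor x u v]Tor_def !Jac_def !TorE; vector_ring2.
vector_ring2.
Qed.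

Lemma gm_Jac_rot x q a b d : U x ->
  gm x (Jac x q b d) a = gm x (Jac x q a b) d.
Proof.
move=> Ux; rewrite !gm_Jac // (TorC _ b q) (TorC _ d a) (TorC _ d q).
rewrite (TorC _ b a) !bilinNl !bilinNr.
rewrite (ch_sym ch (Tor x b d)) // (ch_sym ch (Tor x b a)) //; scalar_lra.
Qed.

Lemma gm_Jac_rot4 x a b d y : U x ->
  gm x (Jac x b d y) a = - gm x (Jac x a b d) y.
Proof.
move=> Ux; rewrite !gm_Jac // (TorC _ y a) (TorC _ b a) (TorC _ b y).
rewrite !bilinNl !bilinNr (ch_sym ch (Tor x d y)) //.
rewrite (ch_sym ch (Tor x d a)) //; scalar_lra.
Qed.

(** [torsion_square_eq0] in an orthonormal basis of the tangent space at [x]. *)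
Lemma Jac_eq0 x u v w : U x -> Jac x u v w = 0.
Proof.
move=> Ux; apply: (bilin_inj (fun _ => ch_pos ch Ux)) => z; rewrite bilin0l.
have G_sym : (G x)^T = G x.
  apply/matrixP => i j; have := ch_sym ch (delta_mx 0 i) (delta_mx 0 j) Ux.
  by rewrite /bilin -!rowE !trmx_delta -!colE !mxE.
have G_pos (y : E) : y != 0 -> 0 < (y *m G x *m y^T) 0 0.
  by move=> y0; exact: (ch_pos ch Ux y0).
have [e he] := orthonormal_basis G_sym G_pos.
have pars a b : \sum_i gm x a (e i) * gm x b (e i) = gm x a b.
  rewrite [in RHS](he b) (lin_sum _ _ (bilinPr (G x) a)).
  by apply: eq_bigr => i _; rewrite mulrC.
have gJ a b : gm x (J a) b = - gm x a (J b).
  by rewrite -(ch_gJ ch (J a) b) // JstK bilinNl.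
have gJ3 a b c d : gm x (a - J b - J c) d
    = gm x a d + gm x b (J d) + gm x c (J d).
  by rewrite !bilinBl !gJ !opprK.
pose T a b c := gm x (Tor x a b) c.
have Tlin a b : lin (T a b) by move=> k y y'; rewrite /T bilinPr.
have hT : form21 J T.
  split=> //.
  - by move=> a b c; rewrite /T TorC bilinNl.
  - by move=> a b c; rewrite /T (ch_skew ch).
  - move=> a b c; rewrite /T {1}Tor_type //; exact: gJ3.
have sigE a b c d : cyc2 e T T a b c d = gm x (Jac x a b c) d.
  by rewrite gm_Jac // /cyc2 /contr2 !pars.
have CE q a b c d : cyc2 e T (cyc2 e T T q) a b c d
    + cyc2 e (cyc2 e T T q) T a b c d = -3 * gm x (covJac x q a b c) d.
  have p1 y1 y2 y3 y4 : contr2 e T (cyc2 e T T q) y1 y2 y3 y4 =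
      gm x (Tor x y1 y2) (Jac x q y3 y4).
    by rewrite -pars; apply: eq_bigr => i _; rewrite sigE.
  have p2 y1 y2 y3 y4 : contr2 e (cyc2 e T T q) T y1 y2 y3 y4 =
      gm x (Jac x q y1 y2) (Tor x y3 y4).
    by rewrite -pars; apply: eq_bigr => i _; rewrite sigE.
  have D a1 a2 a3 a4 a5 a6 : gm x (a1 + a2 + (a3 + a4) + (a5 + a6)) d =
      gm x a1 d + gm x a2 d + (gm x a3 d + gm x a4 d) + (gm x a5 d + gm x a6 d).
    by rewrite !bilinDl.
  have gm_covTor y1 y2 y3 : gm x (covTor x q y1 y2) y3 =
      - (3^-1 * gm x (Jac x q y1 y2) y3).
    by rewrite covTor_Jac // bilinNl bilinZl.
  have term y1 y2 y3 :
      gm x (covTor x q (Tor x y1 y2) y3) d + gm x (Tor x (covTor x q y1 y2) y3) d =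
      - (3^-1 * (gm x (Tor x y1 y2) (Jac x q y3 d)
                 + gm x (Jac x q y1 y2) (Tor x y3 d))).
    have := gm_covTor (Tor x y1 y2) y3 d; have := gm_covTor y1 y2 (Tor x y3 d).
    have := ch_sym ch (Tor x y1 y2) (Jac x q y3 d) Ux.
    have := gm_Jac_rot q (Tor x y1 y2) y3 d Ux.
    have := ch_skew ch y3 (covTor x q y1 y2) d Ux.
    have := ch_sym ch (covTor x q y1 y2) (Tor x y3 d) Ux.
    rewrite (TorC _ y3 (covTor _ _ _ _)) bilinNl; scalar_lra.
  have covJacE : gm x (covJac x q a b c) d =
      gm x (covTor x q (Tor x a b) c) d + gm x (Tor x (covTor x q a b) c) d +
      (gm x (covTor x q (Tor x b c) a) d + gm x (Tor x (covTor x q b c) a) d) +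
      (gm x (covTor x q (Tor x c a) b) d + gm x (Tor x (covTor x q c a) b) d).
    by rewrite covJac_def; exact: D.
  rewrite /cyc2 !p1 !p2.
  have := term a b c; have := term b c a; have := term c a b.
  move: covJacE; scalar_lra.
apply/eqP; rewrite -sigE; apply/eqP.
apply: (torsion_square_eq0 (@JstP R m) (@JstK R m) _ gJ he hT).
- by move=> y y'; exact: ch_sym ch _ _ _ Ux.
- move=> a b c d; rewrite !sigE {1}Jac_type //; exact: gJ3.
- move=> q a b c d; rewrite !CE -!mulrDr; congr (_ * _).
  by rewrite {1}covJac_type //; exact: gJ3.
- move=> a b c d y; rewrite !CE.
  have -> : \sum_i T a b (e i) * cyc2 e T T (e i) c d y =
      gm x (Jac x (Tor x a b) c d) y.
    have r4 v' := gm_Jac_rot4 v' c d y Ux.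
    have -> : gm x (Jac x (Tor x a b) c d) y =
        - gm x (Tor x a b) (Jac x c d y).
      have := r4 (Tor x a b); have := ch_sym ch (Tor x a b) (Jac x c d y) Ux.
      scalar_lra.
    rewrite -pars -sumrN; apply: eq_bigr => i _; rewrite sigE.
    by have := r4 (e i); rewrite /T => ->; ring.
  have BD y1 y2 y3 : gm x (y1 - y2 + y3) y = gm x y1 y - gm x y2 y + gm x y3 y.
    by rewrite bilinDl bilinBl.
  have := congr1 (fun v => gm x v y) (ricci_Jac a b c d Ux).
  by move=> /(etrans (esym (BD _ _ _))); rewrite bilin0l; scalar_lra.
Qed.

(** The derivative of the metric coefficient of the constant fields [y], [z] first
    along [v], then along [u], in covariant terms. *)
Definition hess x u v y z : R :=
  gm x (cov2 x u v y) z + gm x (Gam x v y) (Gam x u z)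
  + (gm x (Gam x u y) (Gam x v z) + gm x y (cov2 x u v z)).

Lemma is_derive_hess x u v y z : U x ->
  is_derive x u (fun q => 'D_v (fun p => gm p y z) q) (hess x u v y z).
Proof.
move=> Ux; apply: near_eq_is_derive; last first.
  exact: is_deriveD (is_derive_gm Ux (is_covd_Gam u v y Ux) (is_covd_cst x u z))
    (is_derive_gm Ux (is_covd_cst x u y) (is_covd_Gam u v z Ux)).
near=> q; rewrite (ch_metric ch) //; near: q; exact: chart_near.
Unshelve. all: by end_near. Qed.

Lemma hessC x u v y z : U x -> hess x v u y z = hess x u v y z.
Proof.
by move=> Ux; rewrite /hess !(cov2C u v) //; ring.
Qed.

(** Linearity in the first direction of a second derivative is not immediate, as
    the first derivative is only known to be directionally differentiable; by
    [hessC] it is linearity in the other direction. *)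
Lemma hess_lin x v y z : U x -> lin (fun u => hess x u v y z).
Proof.
move=> Ux; have cov2P a u w y' :
    cov2 x v (a *: u + w) y' = a *: cov2 x v u y' + cov2 x v w y'.
  apply: (is_covd_unique Ux _ (is_covd_Gam v _ y' Ux)
    (is_covdD (is_covdZ a (is_covd_Gam v u y' Ux)) (is_covd_Gam v w y' Ux))) => q _.
  exact: chrisPl.
move=> a u w; rewrite !(hessC v) // /hess !cov2P !chrisPl.
rewrite !(bilinPl, bilinPr); ring.
Qed.

(** [h u v y z] is the derivative along [u] and J(v) of omega(y,z), so that
    the sum is the exterior derivative of the form with value d omega(Jb,Jc,Jd)
    on [b], [c], [d], hence of the torsion form up to sign.  As the torsion is
    parallel, its derivatives are terms in the Christoffel symbols; alternated,
    these become T(T(a,b),c) and add up to [Jac], which is zero. *)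
Lemma torsion_closed x a b c d : U x ->
  let h u v y z := hess x u (J v) y (J z) in
  (h a b c d - h a c b d + h a d b c) - (h b a c d - h b c a d + h b d a c)
  + (h c a b d - h c b a d + h c d a b) - (h d a b c - h d b a c + h d c a b)
  = 0.
Proof.
move=> Ux h.
have dT u y z w : - (h u y z w - h u z y w + h u w y z) =
    gm x (Tor x (Gam x u y) z) w + gm x (Tor x y (Gam x u z)) w
    + gm x (Tor x y z) (Gam x u w).
  have k1 := is_derive_gm Ux
    (is_covd_Tor Ux (is_covd_cst x u y) (is_covd_cst x u z)) (is_covd_cst x u w).
  have k2 := is_deriveN (is_deriveD (is_deriveB (is_derive_hess u (J y) z (J w) Ux)
    (is_derive_hess u (J z) y (J w) Ux)) (is_derive_hess u (J w) y (J z) Ux)).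
  have := is_derive_near_unique k2 k1; rewrite covTor_Jac // Jac_eq0 //.
  rewrite scaler0 oppr0 add0r /cst bilinDl; apply.
  near=> q; rewrite (ch_torsion ch) //; near: q; exact: chart_near.
have rot2 u v w : gm x (Tor x v u) w = - gm x (Tor x u v) w.
  by rewrite TorC bilinNl.
have rot3 u v w : gm x (Tor x v w) u = gm x (Tor x u v) w.
  by rewrite (ch_skew ch) // rot2 opprK.
have TT u v w z : gm x (Tor x u v) (Tor x w z) =
    gm x (Tor x (Gam x u v) w) z - gm x (Tor x (Gam x v u) w) z.
  by rewrite -(gm_Tor_Tor) // Tor_Tor bilinBl.
have := congr1 (fun v => gm x v d) (@Jac_eq0 x a b c Ux).
rewrite (gm_Jac a b c d Ux) bilin0l !TT.
have := ch_sym ch (Tor x a b) (Tor x c d) Ux.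
have := ch_sym ch (Tor x b c) (Tor x a d) Ux.
have := ch_sym ch (Tor x a c) (Tor x b d) Ux; rewrite !TT.
have dT' u y z w : - (h u y z w - h u z y w + h u w y z) =
    gm x (Tor x (Gam x u y) z) w - gm x (Tor x (Gam x u z) y) w
    + gm x (Tor x (Gam x u w) y) z.
  by rewrite dT -(rot3 (Gam x u w) y z) (rot2 (Gam x u z) y).
have := dT' a b c d; have := dT' b a c d; have := dT' c a b d.
have := dT' d a b c.
clearbody h.
scalar_lra.
Unshelve. all: by end_near. Qed.

End Chart.

(** * Linear combinations of smooth functions *)
Section Smooth.
Context (R : realType) (m : nat) (U : set 'rV[R]_m).
Hypothesis Uopen : open U.
Implicit Types f h : 'rV[R]_m -> R.

Let U_near x : U x -> \near x, U x.
Proof. by move=> Ux; apply: open_nbhs_nbhs. Qed.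

Lemma smooth_on_cst (c : R) : smooth_on U (cst c).
Proof.
move=> s x _; have -> : iter_derive s (cst c) = cst (if s is [::] then c else 0).
  elim: s => [//|v s IH] /=; apply/funext => y; rewrite IH; exact: derive_cst.
by split=> [|v]; [exact: cst_continuous|exact: derivable_cst].
Qed.

Lemma iter_derive_lin c f h s x : smooth_on U f -> smooth_on U h -> U x ->
  iter_derive s (fun y => c * f y + h y) x =
  c * iter_derive s f x + iter_derive s h x.
Proof.
move=> hf hh; elim: s x => [//|v s IH] x Ux /=.
have [_ df] := hf s x Ux; have [_ dh] := hh s x Ux.
transitivity ('D_v (c *: iter_derive s f + iter_derive s h) x).
  apply: near_eq_derive; near=> y; apply: IH; near: y; exact: U_near.
by rewrite deriveD ?deriveZ //; exact: derivableZ.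
Unshelve. all: by end_near. Qed.

Lemma smooth_on_lin c f h : smooth_on U f -> smooth_on U h ->
  smooth_on U (fun y => c * f y + h y).
Proof.
move=> hf hh s x Ux; have [cf df] := hf s x Ux; have [cg dh] := hh s x Ux.
have e : \near x, (c *: iter_derive s f + iter_derive s h) x =
    iter_derive s (fun y => c * f y + h y) x.
  near=> y; rewrite iter_derive_lin //; near: y; exact: U_near.
split=> [|v].
  rewrite /prop_for /continuous_at -(nbhs_singleton e).
  apply: cvg_trans; first exact: near_eq_cvg e.
  by apply: cvgD => //; apply: cvgZr.
apply: near_eq_derivable e _; apply: derivableD => //; exact: derivableZ.
Unshelve. all: by end_near. Qed.

Lemma smooth_on_sum (I : finType) (F : I -> 'rV[R]_m -> R) (c : I -> R) :
  (forall i, smooth_on U (F i)) -> smooth_on U (fun y => \sum_i c i * F i y).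
Proof.
move=> hF; rewrite (_ : (fun y => _) = fun y => \sum_(i <- enum I) c i * F i y).
  elim: (enum I) => [|i r IH].
    by under eq_fun do rewrite big_nil; exact: smooth_on_cst.
  by under eq_fun do rewrite big_cons; exact: smooth_on_lin.
by apply/funext => y; rewrite big_enum.
Qed.
End Smooth.

Ltac derive_lra := repeat match goal with
  | |- context [?t] => match t with @derive _ _ _ _ _ _ => generalize t; intro end
  end; scalar_lra.

(** * The Strominger-Bismut connection in a chart *)
Section ChartOfManifold.
Context (R : realType) (n : nat) (X : complexManifold R n).
Variables (g : hermitianMetric X) (N : affineConnection X) (a : chart_index X).
Local Notation E := (cvec R n).
Local Notation J := (@Jst R n).
Local Notation U := (cod a).
Local Notation G := (metric_mx g a).
Local Notation Ga := (gamma_mx N a).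
Local Notation gm x := (bilin (G x)).
Local Notation Gam x := (chris (Ga x)).
Local Notation Tor := (Tor Ga).
Local Notation dgm u v w x := ('D_u (fun q => gm q v w) x).

Let Uopen : open U := @cod_open R n X a.

Lemma chart_const_near x (P : E -> Prop) : U x -> (forall q, U q -> P q) ->
  \near x, P x.
Proof.
move=> Ux h; near=> q; apply: h; near: q; exact: open_nbhs_nbhs.
Unshelve. all: by end_near. Qed.

Lemma smooth_map_cst (w : E) : smooth_map_on U (cst w).
Proof. move=> j; exact: smooth_on_cst. Qed.

Lemma cov_cst (C : affineConnection X) u W :
  cov C a (cst u) W = covd (gamma_mx C a) u W.
Proof. by []. Qed.

Lemma cov_cst_cst (C : affineConnection X) u w :
  cov C a (cst u) (cst w) = fun q => chris (gamma_mx C a q) u w.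
Proof. by apply/funext => q; rewrite /cov derive_cst add0r. Qed.

Lemma lie_bracket_cst (u w : E) : lie_bracket (cst u) (cst w) = cst 0.
Proof. by apply/funext => q; rewrite /lie_bracket !derive_cst subrr. Qed.

Lemma cov_zero (C : affineConnection X) W x : cov C a (cst 0) W x = 0.
Proof. by rewrite cov_cst /covd derive0 chris0l addr0. Qed.

Lemma metric_sub x u v : metric g a x u v = gm x u v. Proof. by []. Qed.

Hypothesis sb : is_strominger_bismut g N.
Hypothesis fl : flat N.

Lemma metric_derivable x v : U x -> derivable G x v.
Proof.
move=> Ux; apply/derivable_mxP => i j.
by have [_ h] := metric_smooth g i j [::] Ux; exact: h.
Qed.

Lemma gamma_derivable x v k : U x -> derivable (Ga ^~ k) x v.
Proof.
move=> Ux; apply/derivable_mxP => i j.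
by have [_ h] := gamma_smooth N k i j [::] Ux; exact: h.
Qed.

Lemma dgm_sym x u v w : U x -> dgm u w v x = dgm u v w x.
Proof.
move=> Ux; apply: near_eq_derive; apply: chart_const_near => // q Uq.
exact: Defs.metric_sym.
Qed.

Lemma gm_J x u v : U x -> gm x (J u) v = - gm x u (J v).
Proof. by move=> Ux; rewrite -(metric_J g Ux (J u)) JstK bilinNl. Qed.

Lemma gm_derivable x u v w : U x -> derivable (fun q => gm q v w) x u.
Proof.
move=> Ux.
by have [] := is_derive_bilin (derivableP (@metric_derivable x u Ux))
  (is_derive_cst v x u) (is_derive_cst w x u).
Qed.

Lemma dgm_J x u v w : U x -> dgm u (J v) w x = - dgm u v (J w) x.
Proof.
move=> Ux; rewrite -deriveN; last exact: gm_derivable.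
apply: near_eq_derive; apply: chart_const_near => // q Uq; exact: gm_J.
Qed.

Lemma dgm_JJ x u v w : U x -> dgm u (J v) (J w) x = dgm u v w x.
Proof.
move=> Ux; apply: near_eq_derive; apply: chart_const_near => // q Uq.
exact: metric_J.
Qed.

(** The exterior derivative of omega at (Ju, Jv, Jw); two of the three [J] in each
    term are absorbed by the metric. *)
Definition dcw x u v w : R :=
  dgm (J u) v (J w) x - dgm (J v) u (J w) x + dgm (J w) u (J v) x.

Lemma torsion_formE x u v w : U x ->
  torsion_form g a x (tnth [tuple u; v; w]) = - dcw x u v w.
Proof.
move=> Ux; congr (- _); rewrite /extd /ext /fund_form !big_ord_recl big_ord0 /=.
change ((-1) ^+ 0 * dgm (J u) (J v) (J (J w)) x
  + ((-1) ^+ 1 * dgm (J v) (J u) (J (J w)) x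
  + ((-1) ^+ 2 * dgm (J w) (J u) (J (J v)) x + 0)) = dcw x u v w).
by rewrite !dgm_JJ // expr0 expr1 sqrrN expr1n /dcw; ring.
Qed.

Let LC_spec := projT2 (cid sb).
Let LC := projT1 (cid sb).
Local Notation Lam x := (chris (gamma_mx LC a x)).

Let sb_cst x u v w : U x ->
  gm x (Gam x u v) w = gm x (Lam x u v) w - 2^-1 * dcw x u v w.
Proof.
move=> Ux; have [_ h] := LC_spec.
have := h a _ _ _ (smooth_map_cst u) (smooth_map_cst v) (smooth_map_cst w) x Ux.
rewrite torsion_formE // !cov_cst_cst !metric_sub => ->.
by rewrite mulrN.
Qed.

Let Lam_sym x u v : U x -> Lam x u v = Lam x v u.
Proof.
move=> Ux; have [[h _] _] := LC_spec.
have := h a _ _ (smooth_map_cst u) (smooth_map_cst v) x Ux.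
by rewrite !cov_cst_cst lie_bracket_cst => /eqP; rewrite subr_eq0 => /eqP.
Qed.

Let Lam_metric x u v w : U x ->
  dgm u v w x = gm x (Lam x u v) w + gm x v (Lam x u w).
Proof.
move=> Ux; have [[_ h] _] := LC_spec.
have := h a _ _ _ (smooth_map_cst u) (smooth_map_cst v) (smooth_map_cst w) x Ux.
by rewrite !cov_cst_cst.
Qed.

Let dgm_N1 x u v w : U x -> dgm (- u) v w x = - dgm u v w x.
Proof.
by move=> Ux; rewrite !Lam_metric // !chrisNl bilinNl bilinNr; ring.
Qed.

Let dgm_N3 x u v w : U x -> dgm u v (- w) x = - dgm u v w x.
Proof.
by move=> Ux; rewrite !Lam_metric // !chrisNr !bilinNr; ring.
Qed.

(** Koszul formula for constant fields; the torsion term is the only change from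
    the Levi-Civita connection. *)
Lemma koszul x u v w : U x -> 2 * gm x (Gam x u v) w =
  dgm u v w x + dgm v u w x - dgm w u v x - dcw x u v w.
Proof.
move=> Ux; rewrite sb_cst // !Lam_metric //.
rewrite (Lam_sym v u) // (Lam_sym w u) // (Lam_sym w v) //.
rewrite (Defs.metric_sym g Ux v (Lam x u w)) (Defs.metric_sym g Ux u (Lam x v w)).
by field.
Qed.

(** The obstruction g(Gam(u,Jv),z) + g(Gam(u,v),Jz) is by [koszul] a sum of first
    derivatives of the metric, in which those from d omega cancel the rest. *)
Lemma Gam_complex x u v : U x -> Gam x u (J v) = J (Gam x u v).
Proof.
move=> Ux; apply: (bilin_inj (metric_pos g Ux)) => z; rewrite gm_J //.
have := koszul u (J v) z Ux; have := koszul u v (J z) Ux.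
rewrite /dcw !JstK !dgm_N1 // !dgm_N3 // dgm_JJ // (dgm_J u v z) //.
derive_lra.
Qed.

Lemma Tor_dcw x u v w : U x -> gm x (Tor x u v) w = - dcw x u v w.
Proof.
move=> Ux; rewrite Tor_def bilinBl.
have := koszul u v w Ux; have := koszul v u w Ux; rewrite /dcw.
rewrite (dgm_sym w u v) // (dgm_sym (J w) (J u) v) // (dgm_J (J w) u v) //.
derive_lra.
Qed.

Lemma flat_chart : bismut_flat_chart U G Ga.
Proof.
have skew x u v w : U x -> gm x (Tor x u v) w = - gm x (Tor x u w) v.
  move=> Ux; rewrite !Tor_dcw // /dcw (dgm_sym (J u) (J v) w) //.
  by rewrite (dgm_J (J u) v w) //; ring.
split=> //.
- move=> x v Ux; exact: metric_derivable.
- move=> x v k Ux; exact: gamma_derivable.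
- move=> x u v Ux; exact: Defs.metric_sym.
- move=> x u Ux; exact: metric_pos.
- move=> x u v Ux; exact: metric_J.
- move=> x u v w Ux; have := koszul u v w Ux; have := koszul u w v Ux.
  rewrite (Defs.metric_sym g Ux v) /dcw (dgm_sym u v w) // (dgm_sym (J u) (J v) w) //.
  rewrite (dgm_J (J u) v w) //; derive_lra.
- move=> x u v Ux; exact: Gam_complex.
- move=> x u v w Ux; exact: Tor_dcw.
- move=> x u v w Ux; apply/eqP; rewrite -subr_eq0; apply/eqP.
  have := fl (smooth_map_cst u) (smooth_map_cst v) (smooth_map_cst w) Ux.
  by rewrite /curvature lie_bracket_cst cov_zero subr0 !cov_cst_cst !cov_cst.
- move=> x u v w z Ux; apply/eqP; rewrite -subr_eq0; apply/eqP.
  (* Flatness applies to smooth fields, so T(w,z) has to be one. *)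
  have sT : smooth_map_on U (fun q => Tor q w z).
    move=> k.
    rewrite (_ : (fun q => _) = fun q => \sum_(p : 'I_(n + n) * 'I_(n + n))
      (w 0 p.1 * z 0 p.2 - z 0 p.1 * w 0 p.2) * Ga q k p.1 p.2).
      by apply: smooth_on_sum => // p; exact: gamma_smooth.
    have bilinE M (y y' : E) : bilin M y y' =
        \sum_(p : 'I_(n + n) * 'I_(n + n)) y 0 p.1 * y' 0 p.2 * M p.1 p.2.
      rewrite /bilin mxE; under eq_bigr do rewrite !mxE mulr_suml.
      rewrite exchange_big pair_bigA; apply: eq_bigr => p _ /=; ring.
    apply/funext => q; rewrite Tor_def !mxE !bilinE -sumrB.
    by apply: eq_bigr => p _; ring.
  have := fl (smooth_map_cst u) (smooth_map_cst v) sT Ux.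
  by rewrite /curvature lie_bracket_cst cov_zero subr0 !cov_cst.
Qed.
End ChartOfManifold.

(** * The operators del and delbar *)
Local Open Scope complex_scope.

Section Dolbeault.
Context (R : realType) (n : nat).
Local Notation vec := (cvec R n).
Local Notation J := (@Jst R n).
Local Notation I := (0 +i* 1 : R[i]).

Lemma eq_cplx (x y : R[i]) : complex.Re x = complex.Re y ->
  complex.Im x = complex.Im y -> x = y.
Proof. by case: x y => [a b] [c d] /= -> ->. Qed.

Lemma II : I * I = -1.
Proof. by apply: eq_cplx; rewrite /= ?mulr0 ?mul0r ?mulr1 ?sub0r ?addr0 ?oppr0. Qed.

Lemma cplxE (a b : R) : a +i* b = a%:C + I * b%:C.
Proof. by apply: eq_cplx; rewrite /=; ring. Qed.

Lemma lin_basis (f : vec -> R) u : lin f -> f u =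
  \sum_j (u 0 (lshift n j) * f (delta_mx 0 (lshift n j))
  + u 0 (rshift n j) * f (delta_mx 0 (rshift n j))).
Proof.
move=> hf; rewrite {1}[u]row_sum_delta (lin_sum _ _ hf) big_split_ord /=.
by rewrite -big_split.
Qed.

Definition lin_derive (F : vec -> R[i]) x :=
  lin (fun u => 'D_u (fun y => complex.Re (F y)) x) /\
  lin (fun u => 'D_u (fun y => complex.Im (F y)) x).

Lemma derive_cplx_basis F x u : lin_derive F x -> derive_cplx u F x =
  \sum_j ((u 0 (lshift n j))%:C * d_x j F x + (u 0 (rshift n j))%:C * d_y j F x).
Proof.
move=> [h1 h2]; rewrite /derive_cplx (lin_basis _ h1) (lin_basis _ h2).
rewrite cplxE !rmorph_sum /= mulr_sumr -big_split; apply: eq_bigr => j _ /=.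
have h a b p q r t : (a * p + b * r)%:C + I * (a * q + b * t)%:C =
    a%:C * (p +i* q) + b%:C * (r +i* t).
  by apply: eq_cplx; rewrite /=; ring.
exact: h.
Qed.

Lemma Jst_l (u : vec) j : J u 0 (lshift n j) = - u 0 (rshift n j).
Proof. by rewrite /Jst row_mxEl !mxE. Qed.
Lemma Jst_r (u : vec) j : J u 0 (rshift n j) = u 0 (lshift n j).
Proof. by rewrite /Jst row_mxEr mxE. Qed.

(** The (1,0) part of the differential of [F], applied to the real vector [u]. *)
Lemma dz_sum F x u : lin_derive F x -> \sum_j dz j u * d_z j F x =
  2^-1 * (derive_cplx u F x - I * derive_cplx (J u) F x).
Proof.
move=> h; rewrite !derive_cplx_basis // mulr_sumr -sumrB mulr_sumr.
apply: eq_bigr => j _; rewrite Jst_l Jst_r /dz cplxE /d_z rmorphN.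
set X := d_x j F x; set Y := d_y j F x.
set a := (u 0 _)%:C; set b := (u 0 _)%:C; move: II; set i := I => ii.
have -> : (a + i * b) * (2^-1 * (X - i * Y)) =
  2^-1 * (a * X - i * (a * Y) + i * (b * X) - i * i * (b * Y)) by ring.
rewrite ii; ring.
Qed.

Lemma dzbar_sum F x u : lin_derive F x -> \sum_j dzbar j u * d_zbar j F x =
  2^-1 * (derive_cplx u F x + I * derive_cplx (J u) F x).
Proof.
move=> h; rewrite !derive_cplx_basis // mulr_sumr -big_split mulr_sumr.
apply: eq_bigr => j _ /=; rewrite Jst_l Jst_r /dzbar /d_zbar rmorphN.
rewrite (cplxE (u 0 (lshift n j)) (- u 0 (rshift n j))).
rewrite (rmorphN (real_complex R)).
set X := d_x j F x; set Y := d_y j F x.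
set a := (u 0 _)%:C; set b := (u 0 _)%:C; move: II; set i := I => ii.
have -> : (a + i * - b) * (2^-1 * (X + i * Y)) =
  2^-1 * (a * X + i * (a * Y) - i * (b * X) - i * i * (b * Y)) by ring.
rewrite ii; ring.
Qed.
End Dolbeault.

(** * The form del delbar omega through real second derivatives *)
Section DelDelbar.
Context (R : realType) (n : nat).
Local Notation vec := (cvec R n).
Local Notation J := (@Jst R n).
Local Notation I := (0 +i* 1 : R[i]).

(** [H x u v] is the derivative of [w] along [v], then [u]; an expression for it
    from which symmetry and linearity can be read off is supplied by flatness. *)
Variables (U : set vec) (w : vec -> vec -> vec -> R)
  (H : vec -> vec -> vec -> vec -> vec -> R).
Hypothesis Uopen : open U.
Hypothesis w_lin : forall x k l, U x -> lin (fun u => 'D_u (fun q => w q k l) x).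
Hypothesis w_hess : forall x u v k l, U x ->
  is_derive x u (fun q => 'D_v (fun p => w p k l) q) (H x u v k l).
Hypothesis H_sym : forall x u v k l, U x -> H x v u k l = H x u v k l.
Hypothesis H_lin : forall x v k l, U x -> lin (fun u => H x u v k l).

Let form2 (y : vec) (v : 'I_2 -> vec) : R[i] := (w y (v ord0) (v ord_max))%:C.

Let half_cplx (a b : R) : 2^-1 * (a +i* b) = (2^-1 * a) +i* (2^-1 * b).
Proof.
rewrite cplxE [RHS]cplxE !rmorphM /= fmorphV rmorph_nat; ring.
Qed.

Let half_del (a b c d : R) : 2^-1 * ((a +i* b) - I * (c +i* d)) =
  2^-1 * (a + d) +i* (2^-1 * (b - c)).
Proof. by rewrite -half_cplx; congr (_ * _); apply: eq_cplx; rewrite /=; ring. Qed.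

Let half_delbar (a b c d : R) : 2^-1 * ((a +i* b) + I * (c +i* d)) =
  2^-1 * (a - d) +i* (2^-1 * (b + c)).
Proof. by rewrite -half_cplx; congr (_ * _); apply: eq_cplx; rewrite /=; ring. Qed.

Let alternate3 (a b c a' b' c' : R) :
  (-1) ^+ 0 * (a +i* a') + ((-1) ^+ 1 * (b +i* b') + ((-1) ^+ 2 * (c +i* c') + 0))
  = (a - b + c) +i* (a' - b' + c').
Proof. by apply: eq_cplx; rewrite expr0 expr1 sqrrN expr1n /=; ring. Qed.

Let alternate4 (a b c d a' b' c' d' : R) :
  (-1) ^+ 0 * (a +i* a') + ((-1) ^+ 1 * (b +i* b') + ((-1) ^+ 2 * (c +i* c')
    + ((-1) ^+ 3 * (d +i* d') + 0))) = (a - b + c - d) +i* (a' - b' + c' - d').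
Proof.
by apply: eq_cplx; rewrite expr0 expr1 (exprS _ 2) sqrrN expr1n /=; ring.
Qed.

Let dbar2 (x a b c : vec) : R :=
  2^-1 * 'D_a (fun q => w q b c) x - 2^-1 * 'D_b (fun q => w q a c) x
  + 2^-1 * 'D_c (fun q => w q a b) x.
Let dbarJ2 (x a b c : vec) : R :=
  2^-1 * 'D_(J a) (fun q => w q b c) x - 2^-1 * 'D_(J b) (fun q => w q a c) x
  + 2^-1 * 'D_(J c) (fun q => w q a b) x.

Lemma delbar_form2 x (v : nat -> vec) : U x ->
  delbar form2 x (fun i => v i) =
  dbar2 x (v 0%N) (v 1%N) (v 2%N) +i* dbarJ2 x (v 0%N) (v 1%N) (v 2%N).
Proof.
move=> Ux; have key a b c :
    \sum_j dzbar j a * d_zbar j (fun q => (w q b c)%:C) x =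
    2^-1 * 'D_a (fun q => w q b c) x +i* (2^-1 * 'D_(J a) (fun q => w q b c) x).
  rewrite dzbar_sum.
    by rewrite /derive_cplx /= !derive_cst half_delbar subr0 add0r.
  split; first exact: w_lin.
  by move=> k u u'; rewrite /= !derive_cst; ring.
rewrite /delbar /ext /form2 !big_ord_recl big_ord0 /= !key /bump /=.
exact: alternate3.
Qed.

Let hess3 x u a b c : R := 2^-1 * H x u a b c - 2^-1 * H x u b a c
  + 2^-1 * H x u c a b.
Let hessJ3 x u a b c : R := 2^-1 * H x u (J a) b c - 2^-1 * H x u (J b) a c
  + 2^-1 * H x u (J c) a b.

Let is_derive_dbar x u a b c : U x ->
  is_derive x u (fun q => dbar2 q a b c) (hess3 x u a b c).
Proof.
move=> Ux; have h a' b' c' := is_deriveZ 2^-1 (w_hess u a' b' c' Ux).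
exact: is_deriveD (is_deriveB (h a b c) (h b a c)) (h c a b).
Qed.

Let is_derive_dbarJ x u a b c : U x ->
  is_derive x u (fun q => dbarJ2 q a b c) (hessJ3 x u a b c).
Proof.
move=> Ux; have h a' b' c' := is_deriveZ 2^-1 (w_hess u (J a') b' c' Ux).
exact: is_deriveD (is_deriveB (h a b c) (h b a c)) (h c a b).
Qed.

(** On real vectors del is half of d minus i times its composite with [J], and
    delbar its conjugate.  The real part of the composite consists of second
    derivatives along (u,v) plus those along (Ju,Jv), which are symmetric in [u]
    and [v] and cancel in the alternating sum.  In the imaginary part the
    derivatives along (u,Jv) and (Ju,v) reinforce each other and add up to the
    expression of the hypothesis. *)
Lemma del_delbar_form2 x (v : 'I_4 -> vec) : U x ->
  (forall a b c d, let h a b c d := H x a (J b) c d in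
   (h a b c d - h a c b d + h a d b c) - (h b a c d - h b c a d + h b d a c)
   + (h c a b d - h c b a d + h c d a b) - (h d a b c - h d b a c + h d c a b)
   = 0) ->
  del (delbar form2) x v = 0.
Proof.
move=> Ux closed; pose F (v : nat -> vec) q := delbar form2 q (fun i => v i).
have Re_der a u : 'D_u (fun q => complex.Re (F a q)) x =
    hess3 x u (a 0%N) (a 1%N) (a 2%N).
  rewrite -[RHS](@derive_val _ _ _ _ _ _ _ (is_derive_dbar u _ _ _ Ux)).
  apply: near_eq_derive; near=> q; rewrite /F delbar_form2 //.
  by near: q; exact: open_nbhs_nbhs.
have Im_der a u : 'D_u (fun q => complex.Im (F a q)) x =
    hessJ3 x u (a 0%N) (a 1%N) (a 2%N).
  rewrite -[RHS](@derive_val _ _ _ _ _ _ _ (is_derive_dbarJ u _ _ _ Ux)).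
  apply: near_eq_derive; near=> q; rewrite /F delbar_form2 //.
  by near: q; exact: open_nbhs_nbhs.
have key a u : \sum_j dz j u * d_z j (F a) x =
  2^-1 * (hess3 x u (a 0%N) (a 1%N) (a 2%N) + hessJ3 x (J u) (a 0%N) (a 1%N) (a 2%N))
  +i* (2^-1 * (hessJ3 x u (a 0%N) (a 1%N) (a 2%N)
               - hess3 x (J u) (a 0%N) (a 1%N) (a 2%N))).
  rewrite dz_sum; first by rewrite /derive_cplx !Re_der !Im_der half_del.
  split=> k y y'; rewrite ?Re_der ?Im_der /hess3 /hessJ3 !H_lin //; ring.
have -> : v = fun i => v (inord i) by apply/funext => i; rewrite inord_val.
rewrite /del /ext !big_ord_recl big_ord0 /=.
pose K s := \sum_j dz j (v (inord s)) * d_z j (F (fun k => v (inord (bump s k)))) x.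
change ((-1) ^+ 0 * K 0%N + ((-1) ^+ 1 * K 1%N + ((-1) ^+ 2 * K 2%N
  + ((-1) ^+ 3 * K 3%N + 0))) = 0).
have KE s : K s = _ := key (fun k => v (inord (bump s k))) (v (inord s)).
rewrite !KE /bump /= !add1n !add0n.
move: (v (inord 0)) (v (inord 1)) (v (inord 2)) (v (inord 3)) => a b c d.
rewrite alternate4 /hess3 /hessJ3.
have S p q y z : H x q p y z = H x p q y z := H_sym p q y z Ux.
apply: eq_cplx => /=.
  (* Real part: every second derivative occurs twice with opposite signs. *)
  rewrite (S a b) (S (J a) (J b)) (S a c) (S (J a) (J c)) (S a d).
  rewrite (S (J a) (J d)) (S b c) (S (J b) (J c)) (S b d) (S (J b) (J d)).
  by rewrite (S c d) (S (J c) (J d)); ring.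
have := closed a b c d.
rewrite /= (S a (J b)) (S a (J c)) (S a (J d)) (S b (J a)) (S b (J c)).
rewrite (S b (J d)) (S c (J a)) (S c (J b)) (S c (J d)) (S d (J a)) (S d (J b)).
rewrite (S d (J c)); lra.
Unshelve. all: by end_near. Qed.
End DelDelbar.

Theorem theorem9 (R : realType) (n : nat) (X : complexManifold R n)
  (g : hermitianMetric X) (N : affineConnection X) :
  is_strominger_bismut g N -> flat N -> pluriclosed g.
Proof.
move=> sb fl a x Ux v; have ch := flat_chart a sb fl.
apply: (del_delbar_form2 (U := cod a)
  (w := fun y k l => bilin (metric_mx g a y) k (Jst l))
  (H := fun y u u' k l =>
    hess (metric_mx g a) (gamma_mx N a) y u u' k (Jst l))) => //.
- exact: cod_open.
- by move=> y k l Uy c u u'; rewrite !(ch_metric ch) // !chrisPl bilinPl bilinPr; ring.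
- by move=> y u u' k l Uy; exact: (is_derive_hess ch).
- by move=> y u u' k l Uy; exact: (hessC ch).
- by move=> y u k l Uy; exact: (hess_lin ch).
- by move=> b c d f; exact: (torsion_closed ch).
Qed.
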